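(* Let $\hat{\mathfrak h}$ be the Lie algebra with basis $\{h(n)\mid n\in\mathbb Z\}\cup\{1\}$, where $1$ and $h(0)$ are central and $[h(m),h(n)]=m\,\delta_{m+n,0}\,1$ for all $m,n\in\mathbb Z$. Let it act on $S=\mathbb C[h(-1),h(-2),h(-3),\dots]$ as follows: for $n<0$, $h(n)$ acts by multiplication; for $n>0$, $h(n)$ acts as $n\,\partial/\partial h(-n)$; $h(0)$ acts as $0$; and $1$ acts as the identity. Put $h(x)=\sum_{n\in\mathbb Z}h(n)x^{-n}$. For independent commuting formal variables $y_1,y_2,x$ define $$\bar L^{(y_1,y_2)}(x)=\tfrac12\Big({:}h(e^{y_1}x)h(e^{y_2}x){:}-\frac{\partial}{\partial y_1}\frac{1}{1-e^{-y_1+y_2}}\Big),$$ where ${:}h(e^{y_1}x)h(e^{y_2}x){:}=\sum_{m,n\in\mathbb Z}{:}h(m)h(n){:}\,e^{-my_1-ny_2}x^{-m-n}$ (the exponentials expanded as formal power series), ${:}\cdot{:}$ denotes normal ordering (each $h(k)$ with $k>0$ placed to the right of each $h(k)$ with $k<0$), and $\frac{1}{1-e^{-y_1+y_2}}$ denotes the formal Laurent series $(y_1-y_2)^{-1}F(y_1,y_2)$, where $F(y_1,y_2)$ is the formal power series $\frac{y_1-y_2}{1-e^{-(y_1-y_2)}}$ and $(y_1-y_2)^{-1}=\sum_{k\ge0}y_2^k y_1^{-k-1}$. Let $\delta(x)=\sum_{n\in\mathbb Z}x^n$. Then, as operators on $S$, with independent commuting formal variables $x_1,x_2,y_1,y_2,y_3,y_4$,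 \begin{align*} [\bar L^{(y_1,y_2)}(x_1),\bar L^{(y_3,y_4)}(x_2)] &=-\tfrac12\frac{\partial}{\partial y_1}\Big(\bar L^{(-y_1+y_2+y_3,\,y_4)}(x_2)\,\delta\!\Big(\frac{e^{y_1}x_1}{e^{y_3}x_2}\Big)+\bar L^{(-y_1+y_2+y_4,\,y_3)}(x_2)\,\delta\!\Big(\frac{e^{y_1}x_1}{e^{y_4}x_2}\Big)\Big)\\ &\quad-\tfrac12\frac{\partial}{\partial y_2}\Big(\bar L^{(y_1-y_2+y_3,\,y_4)}(x_2)\,\delta\!\Big(\frac{e^{y_2}x_1}{e^{y_3}x_2}\Big)+\bar L^{(y_1-y_2+y_4,\,y_3)}(x_2)\,\delta\!\Big(\frac{e^{y_2}x_1}{e^{y_4}x_2}\Big)\Big). \end{align*}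
   Context: All variables are commuting formal variables and all identities are identities of formal series with operator coefficients (each coefficient acting on any fixed vector of $S$ by a finite sum). Expressions such as $\delta\big(\frac{e^{y_1}x_1}{e^{y_3}x_2}\big)=\sum_{n\in\mathbb Z}e^{n(y_1-y_3)}x_1^nx_2^{-n}$ are expanded with the exponentials as formal power series. In $\bar L^{(a,b)}(x_2)$ with $a,b$ linear combinations of the $y_i$ as on the right-hand side, the substitution is made into the defining formula; negative powers of a sum of formal variables arising (e.g. $(a-b)^{-1}$) are, following the paper's convention for binomial expansions, expanded in nonnegative powers of all summands other than the first. *)

(* Defs.v *)
From HB Require Import structures.
From mathcomp Require Import all_boot all_order all_algebra.
From mathcomp Require Import finmap.
From mathcomp.multinomials Require Import monalg.
From mathcomp Require Import boolp classical_sets fsbigop.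
From mathcomp Require Import complex Rstruct.

Set Implicit Arguments.
Unset Strict Implicit.
Unset Printing Implicit Defensive.
Import Order.TTheory GRing.Theory Num.Theory.
Local Open Scope ring_scope.

Definition CC : fieldType := Rdefinitions.R[i].

(* S = C[h(-1), h(-2), h(-3), ...]: polynomials in countably many     *)
(* variables; the variable with index j : nat stands for h(-(j+1)).    *)
Definition mon := {cmonom nat}.
Definition S := {malg CC[mon]}.

Definition hmul (j : nat) (v : S) : S := << ucm j >> * v.
Definition hder (j : nat) (v : S) : S :=
  \sum_(m <- msupp v) (v@_m * (m j)%:R) *: << divcm m (ucm j) >>.

Definition hop (n : int) : S -> S :=
  match n with
  | Posz 0 => fun _ => 0
  | Posz k.+1 => fun v => k.+1%:R *: hder k v
  | Negz k => hmul k
  end.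

Definition nop (m n : int) (v : S) : S :=
  if (0 < m) && (n < 0) then hop n (hop m v)
  else hop m (hop n v).

(* Formal series in x1, x2, y1, y2, y3, y4.  An exponent is a row      *)
(* vector k in Z^6; index 0 <-> x1, 1 <-> x2, q+1 <-> y_q (q=1..4).    *)
Definition E := 'rV[int]_6.
Definition X1 : 'I_6 := inord 0.
Definition X2 : 'I_6 := inord 1.
Definition Yv (q : nat) : 'I_6 := inord q.+1.

(* y-exponents and linear forms in y1..y4 live in Z^4 *)
Definition lin := 'rV[int]_4.
Definition yv (q : nat) : lin := delta_mx 0 (inord q.-1).
Definition ypart (k : E) : lin := \row_(q < 4) k 0 (inord q.+2).

Definition ser := E -> CC.
(* operator-valued series: the coefficient of monomial k is the       *)
(* operator  v |-> A v k  on S                                         *)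
Definition opser := S -> E -> S.

(* All (possibly infinite-looking) sums below are sums of families     *)
(* with finite support (fsbigop), as in the paper's convention.        *)
Definition opmul (A B : opser) : opser := fun v k =>
  \sum_(i \in @setT E) A (B v (k - i)) i.
Definition scmul (c : ser) (A : opser) : opser := fun v k =>
  \sum_(i \in @setT E) c i *: A v (k - i).
Definition opadd (A B : opser) : opser := fun v k => A v k + B v k.
Definition opscale (c : CC) (A : opser) : opser := fun v k => c *: A v k.
Definition opbr (A B : opser) : opser := fun v k => opmul A B v k - opmul B A v k.
Definition dop (i : 'I_6) (A : opser) : opser := fun v k =>
  (k 0 i + 1)%:~R *: A v (k + delta_mx 0 i).

(* coefficient of y^kap in exp(lam . y) = prod_q exp(lam_q y_q) *)
Definition expco (lam kap : lin) : CC :=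
  if [forall q, 0 <= kap 0 q]
  then \prod_(q < 4) ((lam 0 q)%:~R ^+ absz (kap 0 q) / ((absz (kap 0 q))`!)%:R)
  else 0.

Definition ser4 := lin -> CC.
Definition one4 : ser4 := fun kap => (kap == 0)%:R.
Definition smul4 (f g : ser4) : ser4 := fun kap =>
  \sum_(i \in @setT lin) f i * g (kap - i).
Definition spow4 (f : ser4) (i : nat) : ser4 := iter i (smul4 f) one4.

Definition gbin (j : int) (i : nat) : CC :=
  (\prod_(t < i) (j - t%:Z)%:~R) / (i`!)%:R.

Definition fstv (l : lin) : 'I_4 :=
  odflt ord0 [pick p : 'I_4 | (l 0 p != 0) &&
                              [forall q : 'I_4, (q < p)%N ==> (l 0 q == 0)]].
Definition rest (l : lin) : ser4 := fun kap =>
  \sum_(q < 4 | q != fstv l) (l 0 q)%:~R * (kap == delta_mx 0 q)%:R.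

(* l^j for j : int, expanded in nonnegative powers of all summands     *)
(* other than the first one l_p y_p:                                   *)
(*   l^j = sum_(i >= 0) binom(j,i) (l_p y_p)^(j-i) (rest l)^i          *)
Definition lpow (l : lin) (j : int) : ser4 := fun kap =>
  let p := fstv l in
  \sum_(i \in @setT nat)
     gbin j i * (l 0 p)%:~R ^ (j - i%:Z) *
     spow4 (rest l) i (kap - (j - i%:Z) *: delta_mx 0 p).

(* F(t) = t / (1 - e^{-t}) as a formal power series: the inverse of  *)
(* u(t) = (1 - e^{-t}) / t = sum_k (-1)^k t^k / (k+1)!.                *)
Definition uco (k : nat) : CC := (-1) ^+ k / ((k.+1)`!)%:R.
Fixpoint Fseq (n : nat) : seq CC :=
  if n is n'.+1 then
    let s := Fseq n' in rcons s (- \sum_(i < n'.+1) uco (n'.+1 - i) * s`_i)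
  else [:: 1].
Definition Fco (n : nat) : CC := (Fseq n)`_n.

(* 1/(1 - e^{-t}) = t^{-1} F(t), a Laurent series in one variable t *)
Definition gco (j : int) : CC := if 0 <= j + 1 then Fco (absz (j + 1)) else 0.
Definition dgco (j : int) : CC := (j + 1)%:~R * gco (j + 1).

(* (d/da (1/(1-e^{-a+b}))) with t := a - b = l substituted:           *)
(*   sum_j dgco_j l^j, each l^j expanded as in lpow                    *)
Definition csub (l : lin) : ser4 := fun kap =>
  \sum_(j \in @setT int) dgco j * lpow l j kap.

(* :h(e^a x)h(e^b x):  for the variable x of index xi (x1 or x2):      *)
(*   sum_(m,n) :h(m)h(n): e^{-m a - n b} x^{-m-n}                       *)
Definition NO (a b : lin) (xi : 'I_6) : opser := fun v k =>
  if [forall j : 'I_6, ((j < 2)%N && (j != xi)) ==> (k 0 j == 0)] then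
    \sum_(m \in @setT int)
       expco (- (m *: a) - ((- k 0 xi - m) *: b)) (ypart k) *:
         nop m (- k 0 xi - m) v
  else 0.

Definition Lbar (a b : lin) (xi : 'I_6) : opser := fun v k =>
  2^-1 *: (NO a b xi v k -
           (if (k 0 X1 == 0) && (k 0 X2 == 0)
            then csub (a - b) (ypart k) *: v else 0)).

(* delta(e^a x1 / (e^b x2)) = sum_n e^{n(a-b)} x1^n x2^{-n} *)
Definition Delta (a b : lin) : ser := fun k =>
  if k 0 X2 == - k 0 X1 then expco (k 0 X1 *: (a - b)) (ypart k) else 0.

(* Main.v *)
Require Import Defs.
From HB Require Import structures.
From mathcomp Require Import all_boot all_order all_algebra.
From mathcomp Require Import finmap.
From mathcomp.multinomials Require Import monalg.
From mathcomp Require Import boolp classical_sets fsbigop.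
From mathcomp Require Import complex Rstruct zify ring.

Set Implicit Arguments.
Unset Strict Implicit.
Unset Printing Implicit Defensive.
Import Order.TTheory GRing.Theory Num.Theory.
Local Open Scope ring_scope.

(** The Heisenberg relations turn the commutator of two quadratic modes into four
    terms [m delta h h]; putting each product [h h] in normal order leaves the
    normally ordered part of the right-hand side and, in total degree [0], a scalar.

    The normally ordered parts agree mode by mode: multiplying by the delta
    function only shifts exponents of exponentials, and [d/dy] acts on [exp (lam y)] as
    multiplication by a coordinate of [lam].

    For the scalars, write [g t = 1 / (1 - exp (- t))], [u = y1 - y2 - y3 + y4] and let
    [- M] be the exponent of [x1]. All Laurent series on the right are expanded with
    [y1] leading, and [g'] is even, so the terms with [(y1, y3)] and [(y2, y4)] combine to
    [exp (- M (y2 - y4))] times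
    [d/du (exp (- M u) g' (u)) - g'' (u) - M g' (u)], the substitution of [u] into a Laurent
    series in one variable. Applying [- M d/dt - d^2/dt^2] to the telescoping identity
    [g t - exp (- M t) g t = sum_(0 <= m < M) exp (- m t)] shows that this series equals
    [sum_m m (M - m) exp (- m t)], which is the scalar produced by the commutator. The terms
    with [(y1, y4)] and [(y2, y3)] are treated alike. *)

(** * Heisenberg operators *)

(** A formal sum of infinite support counts as zero and products of Laurent expansions need not be
    associative, so every exchange of summations needs an explicit finite set. On the right, every
    form substituted into [g'] contains [y1] with coefficient 1 or -1; the expansions thus lie in
    one class ([tame]) on which multiplication by an exponential is a finite sum. On the left, the
    constants expanded in [y1 - y2] and in [y3 - y4] multiply the identity, cancel in the bracket,
    and are never compared with those on the right.

    The reduction to one variable rests on homogeneity: [l ^ j] has only monomials of degree [j], so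
    a substituted series has coefficient [c (deg kap)] times a factor depending on [l] and [kap]
    alone. Multiplication by [exp (q l)] and the derivatives in the [y] variables then act on [c]
    itself.

    That [g'] is even comes from [g (t) + g (- t) = 1], proved by uniqueness: the defect is fixed by
    multiplication by [exp (- t)], and [1 - exp (- t)] is not a zero divisor. *)

Lemma CC_natr_neq0 n : (n.+1%:R : CC) != 0.
Proof. by have := pnatr_eq0 (Rdefinitions.R[i]) n.+1; rewrite /= => /negbT. Qed.

Lemma malgUE (K : monomType) (R : comNzRingType) (c : R) (m : K) :
  << c *g m >> = c *: << m >> :> {malg R[K]}.
Proof. by apply/malgP => k; rewrite mcoeffZ !mcoeffU mulr_natr. Qed.

(* Over an abstract module, because conversion between elements of [{malg R[K]}] diverges. *)
Section MonomialBasis.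
Context {I : choiceType} {R : comNzRingType} {V : lmodType R}.
Variables (b : {cmonom I} -> V) (d x : I -> {linear V -> V}).
Hypothesis dE : forall j m, d j (b m) = (m j)%:R *: b (divcm m (ucm j)).
Hypothesis xE : forall i m, x i (b m) = b (mulcm (ucm i) m).

Lemma basis_derC i j m : d i (d j (b m)) = d j (d i (b m)).
Proof.
have [->//|nij] := eqVneq i j.
rewrite !dE !linearZ /= !dE !scalerA !divcmE !ucmE eq_sym (negPf nij) !subn0.
rewrite mulrC; congr (_ *: b _).
by apply/eqP/cmP => l; rewrite !divcmE subnAC.
Qed.

Lemma basis_mulC i j m : x i (x j (b m)) = x j (x i (b m)).
Proof. by rewrite !xE mulcmA [mulcm (ucm i) _]mulcmC -mulcmA. Qed.

Lemma basis_der_mul i j m : d j (x i (b m)) = x i (d j (b m)) + (i == j)%:R *: b m.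
Proof.
rewrite xE !dE linearZ /= xE mulcmE ucmE.
have [->|nij] := eqVneq i j; last first.
  rewrite scale0r addr0; congr (_ *: b _).
  apply/eqP/cmP => l; rewrite !(divcmE, mulcmE, ucmE).
  have [eq_jl|_] := eqVneq j l; last by rewrite !subn0.
  by rewrite -eq_jl (negPf nij) !add0n.
have -> : divcm (mulcm (ucm j) m) (ucm j) = m.
  by apply/eqP/cmP => l; rewrite !(divcmE, mulcmE, ucmE) addKn.
rewrite natrD addrC scalerDl; congr (_ + _).
(* For [m j = 0] the truncated subtraction in [divcm] is not undone by multiplication, but the
   coefficient is then zero. *)
have [->|mj] := eqVneq (m j) 0%N; first by rewrite !scale0r.
congr (_ *: b _); apply/eqP/cmP => l; rewrite !(divcmE, mulcmE, ucmE).
by have [<-|] := eqVneq j l; lia.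
Qed.

End MonomialBasis.

Section PolynomialDerivation.
Context {I : choiceType} {R : comNzRingType}.
Local Notation mon := {cmonom I}.
Local Notation P := {malg R[mon]}.

(** [pmul] and [pder] are [hmul] and [hder] over an arbitrary coefficient ring; their instances at
    [CC] are convertible to the operators on [S]. *)
Definition pmul j (v : P) : P := << ucm j >> * v.
Definition pder j (v : P) : P :=
  \sum_(m <- msupp v) (v@_m * (m j)%:R) *: << divcm m (ucm j) >>.

Lemma pder_is_linear j : linear (pder j).
Proof.
(* The range of summation depends on the argument; over a common larger finite set the sum is
   visibly linear. *)
have pderw (d : {fset mon}) (v : P) : (msupp v `<=` d)%fset ->
    pder j v = \sum_(m <- d) (v@_m * (m j)%:R) *: << divcm m (ucm j) >>.
  move=> le_vd; rewrite /pder (big_fset_incl _ le_vd) // => m _ /mcoeff_outdom->.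
  by rewrite mul0r scale0r.
move=> a u v.
have [s1 s2] := (fsubsetUl (msupp u) (msupp v), fsubsetUr (msupp u) (msupp v)).
have s3 : (msupp (a *: u + v) `<=` msupp u `|` msupp v)%fset.
  by apply: fsubset_trans (msuppD_le _ _) _; apply: fsetSU; apply: msuppZ_le.
rewrite (pderw _ _ s1) (pderw _ _ s2) (pderw _ _ s3) scaler_sumr -big_split /=.
by apply: eq_bigr => m _; rewrite mcoeffD mcoeffZ mulrDl scalerDl scalerA mulrA.
Qed.
HB.instance Definition _ j := GRing.isLinear.Build R P P *:%R (pder j) (pder_is_linear j).

Lemma pmul_is_linear j : linear (pmul j).
Proof. by move=> a u v; rewrite /pmul mulrDr scalerAr. Qed.
HB.instance Definition _ j := GRing.isLinear.Build R P P *:%R (pmul j) (pmul_is_linear j).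

Lemma pderU j m : pder j << m >> = (m j)%:R *: << divcm m (ucm j) >>.
Proof. by rewrite /pder msuppU1 big_seq_fset1 mcoeffUU mul1r. Qed.

Lemma pmulU i m : pmul i << m >> = << mulcm (ucm i) m >>.
Proof. by rewrite /pmul malgM_def fgmulUU mulr1. Qed.

Lemma malg_linear_ext (f g : {linear P -> P}) :
  (forall m, f << m >> = g << m >>) -> f =1 g.
Proof.
move=> fg v; rewrite (monalgE v) !linear_sum; apply: eq_bigr => m _.
by rewrite malgUE !linearZ fg.
Qed.

Lemma pderC i j v : pder i (pder j v) = pder j (pder i v).
Proof.
apply: (malg_linear_ext (f := pder i \o pder j) (g := pder j \o pder i)) => m.
exact: (basis_derC (b := fun m => << m >>) pderU).
Qed.

Lemma pmulC i j v : pmul i (pmul j v) = pmul j (pmul i v).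
Proof.
apply: (malg_linear_ext (f := pmul i \o pmul j) (g := pmul j \o pmul i)) => m.
exact: (@basis_mulC I R P (fun m => << m >>) (fun i => pmul i) pmulU i j m).
Qed.

Lemma pder_pmul i j v : pder j (pmul i v) = pmul i (pder j v) + (i == j)%:R *: v.
Proof.
apply: (malg_linear_ext (f := pder j \o pmul i)
  (g := pmul i \o pder j \+ (i == j)%:R \*: idfun)) => m.
exact: (basis_der_mul (b := fun m => << m >>) pderU pmulU).
Qed.

End PolynomialDerivation.

Lemma pder_eventually0 (R : comNzRingType) (v : {malg R[mon]}) : exists B, forall j, (B <= j)%N
    -> pder j v = 0.
Proof.
(* This bound exceeds the index of every variable occurring in [v]. *)
exists (\max_(m <- msupp v) \max_(i <- finsupp m) i.+1)%N => j lej.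
rewrite /pder big_seq big1 // => m mv.
case: (finsuppP m j) => [|jm]; first by rewrite mulr0 scale0r.
have /= h1 : (\max_(i <- finsupp m) i.+1 <= \max_(m <- msupp v) \max_(i <- finsupp m) i.+1)%N.
  exact: (@leq_bigmax_seq _ _ xpredT (fun m : mon => \max_(i <- finsupp m) i.+1)%N _ mv).
have /= h2 : (j.+1 <= \max_(i <- finsupp m) i.+1)%N.
  exact: (@leq_bigmax_seq _ _ xpredT (fun i => i.+1)%N _ jm).
by have := leq_trans h2 (leq_trans h1 lej); rewrite ltnn.
Qed.

Section Heisenberg.
Context {R : comNzRingType} {V : lmodType R}.
Variables (d x : nat -> {linear V -> V}).
Hypothesis dC : forall i j v, d i (d j v) = d j (d i v).
Hypothesis xC : forall i j v, x i (x j v) = x j (x i v).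
Hypothesis dx : forall i j v, d j (x i v) = x i (d j v) + (i == j)%:R *: v.
Hypothesis d0 : forall v, exists B, forall j, (B <= j)%N -> d j v = 0.

(** The shape of [hop] is repeated for any module with operators satisfying the canonical
    commutation relations, so that [hop] is an instance by conversion. *)
Definition pop (n : int) : V -> V :=
  match n with
  | Posz 0 => fun _ => 0
  | Posz k.+1 => fun v => k.+1%:R *: d k v
  | Negz k => x k
  end.

Lemma pop_is_linear n : linear (pop n).
Proof.
case: n => [[|n]|n] a u v /=; first by rewrite scaler0 addr0.
  by rewrite linearP scalerDr !scalerA mulrC.
by rewrite linearP.
Qed.
HB.instance Definition _ n := GRing.isLinear.Build R V V *:%R (pop n) (pop_is_linear n).

Lemma pop_comm (m n : int) v :
  pop m (pop n v) = pop n (pop m v) + (m *+ (m + n == 0))%:~R *: v.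
Proof.
case: m => [[|m]|m]; case: n => [[|n]|n];
  rewrite /= ?raddf0 ?mul0rn ?scale0r ?addr0 //.
- by rewrite !linearZ /= dC !scalerA mulrC.
- rewrite dx scalerDr [in RHS]linearZ /=; congr (_ + _).
  rewrite scalerA; congr (_ *: _).
  have -> : (Posz m.+1 + Negz n == 0) = (n == m) by lia.
  by case: eqVneq => _; rewrite ?mulr1n ?mulr1 ?mulr0 ?mulr0n.
- rewrite dx scalerDr [in LHS]linearZ /= -addrA scalerA -scalerDl.
  have -> : (Negz m + Posz n.+1 == 0) = (m == n) by lia.
  case: eqVneq => [->|_]; rewrite ?mulr1n ?mulr1 ?mulr0 ?mulr0n ?addr0 ?scale0r ?addr0 //.
  by rewrite NegzE mulrNz subrr scale0r addr0.
Qed.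

Lemma pop_eventually0 v : exists B : nat, forall n : int, B%:Z <= n -> pop n v = 0.
Proof.
have [B hB] := d0 v; exists B.+1 => -[[|j]|j] //= lej.
by rewrite hB ?scaler0.
Qed.

Definition pnop (m n : int) (v : V) : V :=
  if (0 < m) && (n < 0) then pop n (pop m v) else pop m (pop n v).

(** The condition [n < 0] disappears: for [0 < m], a nonzero commutator requires [m + n = 0], which
    already forces [n < 0]. *)
Lemma pnopE m n v :
  pnop m n v = pop m (pop n v) - (m *+ ((0 < m) && (m + n == 0)))%:~R *: v.
Proof.
rewrite /pnop; case: ifPn => [/andP[m0 n0]|].
  by rewrite (pop_comm m) m0 /= addrK.
move=> H; suff -> : (0 < m) && (m + n == 0) = false by rewrite mulr0n scale0r subr0.
by apply: contraNF H => /andP[m0 /eqP mn0]; rewrite m0 /=; lia.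
Qed.

Lemma pnop_is_linear m n : linear (pnop m n).
Proof. by move=> a u v; rewrite /pnop; case: ifP => _; rewrite !linearP. Qed.
HB.instance Definition _ m n :=
  GRing.isLinear.Build R V V *:%R (pnop m n) (pnop_is_linear m n).

Lemma pnopC m n v : pnop m n v = pnop n m v.
Proof.
rewrite !pnopE (pop_comm m n) -addrA -scalerBl -scaleNr; congr (_ + _ *: _).
rewrite -mulrzBr -mulrNz; congr (_%:~R).
have -> : (n + m == 0) = (m + n == 0) by rewrite addrC.
by case: eqVneq => [|_]; rewrite ?andbT ?andbF ?mulr0n ?subr0 ?oppr0 // mulr1n; lia.
Qed.

(** When [m] is far from zero, one of the two indices is a large positive one, and normal ordering
    lets it act on [v] first. This makes every mode sum finite. *)
Lemma pnop_eventually0 N v :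
  exists B : nat, forall m : int, (B < absz m)%N -> pnop m (N - m) v = 0.
Proof.
have [B hB] := pop_eventually0 v; exists (B + absz N)%N => m hm.
have [m0|m0] := ltP 0 m.
  rewrite pnopC pnopE hB ?linear0 ?sub0r; last by lia.
  by rewrite (_ : (0 < N - m) && _ = false) ?mulr0n ?scale0r ?oppr0 //; lia.
rewrite pnopE hB ?linear0 ?sub0r; last by lia.
by rewrite (_ : (0 < m) && _ = false) ?mulr0n ?scale0r ?oppr0 //; lia.
Qed.

(* The normal-ordering corrections are scalars, so they drop out of the bracket. *)
Lemma pnop_bracket m n r s v :
  pnop m n (pnop r s v) - pnop r s (pnop m n v) =
    (n *+ (n + r == 0))%:~R *: pop m (pop s v)
  + (n *+ (n + s == 0))%:~R *: pop m (pop r v)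
  + (m *+ (m + r == 0))%:~R *: pop s (pop n v)
  + (m *+ (m + s == 0))%:~R *: pop r (pop n v).
Proof.
have -> : pnop m n (pnop r s v) - pnop r s (pnop m n v) =
    pop m (pop n (pop r (pop s v))) - pop r (pop s (pop m (pop n v))).
  rewrite !pnopE.
  have lin a b w c u : pop a (pop b (w - c *: u)) = pop a (pop b w) - c *: pop a (pop b u).
    by rewrite (linearB (pop b)) (linearZ_LR (pop b)) (linearB (pop a)) (linearZ_LR (pop a)).
  rewrite !lin !scalerBr !scalerA [X in X *: v]mulrC.
  have zmod_id (A B C D E : V) : A - B - (C - D) - (E - C - (B - D)) = A - E.
    rewrite -[A - B - _]addrA -opprD -[E - C - _]addrA -[- C - _]opprD [C + (B - D)]addrCA.
    by move: (B + _) => X; rewrite opprB addrA subrK.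
  exact: zmod_id.
(* The modes [n] and then [m] are carried past [r] and [s]; each of the four exchanges leaves one
   contraction. *)
rewrite (pop_comm n r) (linearD (pop m)) (linearZ_LR (pop m)) (pop_comm n s).
rewrite !(linearD (pop r), linearD (pop m), linearZ_LR (pop r), linearZ_LR (pop m)) /=.
rewrite (pop_comm m r) (pop_comm m s) (linearD (pop r)) (linearZ_LR (pop r)) /=.
have zmod_id (w a1 a2 a3 a4 : V) : w + a1 + a2 + a3 + a4 - w = a4 + a3 + a2 + a1.
  rewrite addrC !addrA addNr add0r.
  by rewrite addrC [a1 + a2 + a3]addrC [a1 + a2]addrC !addrA.
exact: zmod_id.
Qed.

End Heisenberg.

Lemma hder_is_linear j : linear (hder j).
Proof. exact: (@pder_is_linear nat CC j). Qed.
HB.instance Definition _ j := GRing.isLinear.Build CC S S *:%R (hder j) (hder_is_linear j).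

Lemma hmul_is_linear j : linear (hmul j).
Proof. exact: (@pmul_is_linear nat CC j). Qed.
HB.instance Definition _ j := GRing.isLinear.Build CC S S *:%R (hmul j) (hmul_is_linear j).

Local Definition hd j : {linear S -> S} := hder j.
Local Definition hm j : {linear S -> S} := hmul j.

Lemma hdC i j v : hd i (hd j v) = hd j (hd i v).
Proof. exact: (@pderC nat CC i j v). Qed.

Lemma hmC i j v : hm i (hm j v) = hm j (hm i v).
Proof. exact: (@pmulC nat CC i j v). Qed.

Lemma hdm i j v : hd j (hm i v) = hm i (hd j v) + (i == j)%:R *: v.
Proof. exact: (@pder_pmul nat CC i j v). Qed.

Lemma hd0 v : exists B, forall j, (B <= j)%N -> hd j v = 0.
Proof. exact: (@pder_eventually0 CC v). Qed.

Lemma hop_is_linear n : linear (hop n).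
Proof. exact: (pop_is_linear hd hm n). Qed.
HB.instance Definition _ n := GRing.isLinear.Build CC S S *:%R (hop n) (hop_is_linear n).

Lemma nop_is_linear m n : linear (nop m n).
Proof. exact: (pnop_is_linear hd hm m n). Qed.
HB.instance Definition _ m n := GRing.isLinear.Build CC S S *:%R (nop m n) (nop_is_linear m n).

Lemma nopE m n v :
  nop m n v = hop m (hop n v) - (m *+ ((0 < m) && (m + n == 0)))%:~R *: v.
Proof. exact: (pnopE hdC hmC hdm m n v). Qed.

Lemma nopC m n v : nop m n v = nop n m v.
Proof. exact: (pnopC hdC hmC hdm m n v). Qed.

Lemma nop_eventually0 N v :
  exists B : nat, forall m : int, (B < absz m)%N -> nop m (N - m) v = 0.
Proof. exact: (pnop_eventually0 hdC hmC hdm hd0 N v). Qed.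

Lemma nop_bracket m n r s v :
  nop m n (nop r s v) - nop r s (nop m n v) =
    (n *+ (n + r == 0))%:~R *: hop m (hop s v)
  + (n *+ (n + s == 0))%:~R *: hop m (hop r v)
  + (m *+ (m + r == 0))%:~R *: hop s (hop n v)
  + (m *+ (m + s == 0))%:~R *: hop r (hop n v).
Proof. exact: (pnop_bracket hdC hmC hdm m n r s v). Qed.

(** * Finitely supported sums and exponential series *)

Section FiniteSupport.
Context {V : zmodType}.

Lemma fsum_seq (T : choiceType) (s : seq T) (F : T -> V) :
  uniq s -> (forall i, i \notin s -> F i = 0) ->
  \sum_(i \in @setT T) F i = \sum_(i <- s) F i.
Proof.
move=> us Fs; rewrite (fsbigE s) //; first by apply: eq_bigl => i; rewrite in_setT.
by move=> i _; apply: Fs.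
Qed.

Lemma fsum_inj (I J : choiceType) (h : I -> J) (F : J -> V) :
  injective h -> (forall j, F j != 0 -> exists i, j = h i) ->
  \sum_(j \in @setT J) F j = \sum_(i \in @setT I) F (h i).
Proof.
move=> hI Fh; rewrite -(fsbig_image _ h); last by move=> x y _ _; apply: hI.
apply/esym/fsbig_widen => // j [_ nj] /=; apply: contrapT => /eqP /Fh [i ji].
by apply: nj; exists i.
Qed.

Lemma fsum_shift (G : zmodType) (a : G) (F : G -> V) :
  \sum_(i \in @setT G) F i = \sum_(i \in @setT G) F (i + a).
Proof.
by apply: reindex_fsbigT; exists (fun i => i - a) => i; rewrite ?addrK ?subrK.
Qed.

Lemma fsum_reflect (G : zmodType) (a : G) (F : G -> V) :
  \sum_(i \in @setT G) F i = \sum_(i \in @setT G) F (a - i).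
Proof. by apply: reindex_fsbigT; exists (fun i => a - i) => i; rewrite subKr. Qed.

Lemma fsum_single (T : choiceType) (i0 : T) (F : T -> V) :
  (forall i, F i != 0 -> i = i0) -> \sum_(i \in @setT T) F i = F i0.
Proof.
move=> Fi; rewrite (@fsum_seq _ [:: i0]) // ?big_seq1 // => i.
by rewrite inE; apply: contraNeq => /Fi ->.
Qed.

Definition irange (B : nat) : seq int := [seq i%:Z - B%:Z | i <- iota 0 (B + B).+1].

Lemma mem_irange B m : (m \in irange B) = (absz m <= B)%N.
Proof.
apply/mapP/idP => [[j] | hm]; first by rewrite mem_iota => /andP[_ hj] ->; lia.
exists (absz (m + B%:Z)); last by lia.
by rewrite mem_iota; lia.
Qed.

Lemma irange_uniq B : uniq (irange B).
Proof. by rewrite map_inj_uniq ?iota_uniq // => i j; lia. Qed.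

Lemma fsum_int B (F : int -> V) :
  (forall m, (B < absz m)%N -> F m = 0) ->
  \sum_(m \in @setT int) F m = \sum_(m <- irange B) F m.
Proof.
move=> F0; apply: fsum_seq (irange_uniq B) _ => m.
by rewrite mem_irange -ltnNge; apply: F0.
Qed.

Lemma fsum_nat B (F : int -> V) :
  (forall m, ~~ (0 <= m < B%:Z) -> F m = 0) ->
  \sum_(m \in @setT int) F m = \sum_(i < B) F i%:Z.
Proof.
move=> F0; rewrite (@fsum_seq _ [seq i%:Z | i <- iota 0 B]).
- by rewrite big_map -{1}[B]subn0 big_mkord.
- by rewrite map_inj_uniq ?iota_uniq // => i j [].
- move=> m mB; apply: F0; apply: contra mB => mB; apply/mapP; exists (absz m); last by lia.
  by rewrite mem_iota; lia.
Qed.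

End FiniteSupport.

(** The set [s] contains both indices of every contributing pair, so the two sides are finite double
    sums over [s] and may be exchanged. *)
Lemma fconv_assoc (K : idomainType) (G : zmodType) (e1 e2 f : G -> K) (k : G) (s : seq G) :
  uniq s ->
  (forall i j, e1 j != 0 -> e2 (i - j) != 0 -> f (k - i) != 0 ->
    (i \in s) && (j \in s)) ->
  \sum_(j \in @setT G) e1 j * (\sum_(i \in @setT G) e2 i * f (k - j - i)) =
  \sum_(i \in @setT G) (\sum_(j \in @setT G) e1 j * e2 (i - j)) * f (k - i).
Proof.
move=> us hs.
(* After this shift the argument of [f] no longer involves [j]. *)
have reidx j : \sum_(i \in @setT G) e2 i * f (k - j - i) =
               \sum_(i \in @setT G) e2 (i - j) * f (k - i).
  rewrite [RHS](fsum_shift j).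
  by apply: eq_fsbigr => i _; rewrite addrK opprD [- i - j]addrC addrA.
have {}hs i j : e1 j * (e2 (i - j) * f (k - i)) != 0 -> (i \in s) && (j \in s).
  by rewrite !mulf_eq0 !negb_or => /and3P[]; apply: hs.
under eq_fsbigr do rewrite reidx mulr_fsumr.
under [RHS]eq_fsbigr do rewrite mulr_fsuml.
rewrite (@fsum_seq _ _ s) //; last first.
  move=> j js; apply: fsbig1 => i _; apply: contraNeq js.
  by move=> /hs /andP[].
rewrite [RHS](@fsum_seq _ _ s) //; last first.
  move=> i is_; apply: fsbig1 => j _; apply: contraNeq is_.
  by rewrite -mulrA => /hs /andP[].
under eq_bigr => j _.
  rewrite (@fsum_seq _ _ s) //; last by move=> i; apply: contraNeq => /hs /andP[].
  over.
rewrite exchange_big /=; apply: eq_bigr => i _.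
rewrite (@fsum_seq _ _ s) //; last first.
  by move=> j; apply: contraNeq; rewrite -mulrA => /hs /andP[].
by apply: eq_bigr => j _; rewrite mulrA.
Qed.

Lemma CC_fact_neq0 n : (n`!%:R : CC) != 0.
Proof. by have := fact_gt0 n; case: (n`!)%N => // k _; apply: CC_natr_neq0. Qed.

(* coefficient of [t ^ j] in [exp (q t)] *)
Definition exp_co (q : CC) (j : int) : CC :=
  if 0 <= j then q ^+ absz j / (absz j)`!%:R else 0.

Lemma exp_co_ge0 q j : exp_co q j != 0 -> 0 <= j.
Proof. by rewrite /exp_co; case: ifP => //; rewrite eqxx. Qed.

Lemma exp_co_nat q (n : nat) : exp_co q n = q ^+ n / n`!%:R.
Proof. by []. Qed.

Lemma exp_co_der q j : (j + 1)%:~R * exp_co q (j + 1) = q * exp_co q j.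
Proof.
rewrite /exp_co; case: j => [n|[|n]]; last 2 first.
- by rewrite mul0r mulr0.
- by rewrite /= !mulr0.
have -> : n%:Z + 1 = n.+1%:Z by lia.
have [n0 f0] := (CC_natr_neq0 n, CC_fact_neq0 n).
by rewrite /= factS natrM exprS; field; rewrite f0 nat1r n0.
Qed.

(** The binomial theorem; any cutoff beyond [j] serves because [exp_co q] vanishes at negative
    exponents. *)
Lemma exp_co_conv p q j (B : nat) : j < B%:Z ->
  \sum_(i < B) exp_co p i%:Z * exp_co q (j - i%:Z) = exp_co (p + q) j.
Proof.
case: j => [n|n] hn; last first.
  by rewrite big1 // => i _; rewrite [exp_co q _]/exp_co ifF ?mulr0 //; lia.
rewrite -(big_mkord xpredT (fun i => exp_co p i%:Z * exp_co q (n%:Z - i%:Z))).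
rewrite (@big_cat_nat _ _ _ n.+1) //=.
rewrite [X in _ + X]big_nat [X in _ + X]big1 ?addr0; last first.
  by move=> i /andP[ni _]; rewrite [exp_co q _]/exp_co ifF ?mulr0 //; lia.
rewrite big_mkord addrC exp_co_nat exprDn mulr_suml; apply: eq_bigr => -[k /= kn] _.
have -> : n%:Z - k%:Z = (n - k)%N by lia.
have /(congr1 (fun x : nat => x%:R : CC)) := bin_fact (kn : (k <= n)%N).
rewrite !natrM !exp_co_nat => <-.
have [k0 nk0] := (CC_fact_neq0 k, CC_fact_neq0 (n - k)).
have := CC_fact_neq0 n; rewrite -(bin_fact (kn : (k <= n)%N)) !natrM.
rewrite mulf_eq0 negb_or => /andP[b0 _].
by rewrite -mulr_natr; field; rewrite b0 k0 nk0.
Qed.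

Implicit Types (lam mu kap iot l : lin).

Definition deg (kap : lin) : int := \sum_(q < 4) kap 0 q.

Lemma degD kap1 kap2 : deg (kap1 + kap2) = deg kap1 + deg kap2.
Proof. by rewrite /deg -big_split; apply: eq_bigr => q _; rewrite mxE. Qed.

Lemma degN kap : deg (- kap) = - deg kap.
Proof. by rewrite /deg -sumrN; apply: eq_bigr => q _; rewrite mxE. Qed.

Lemma degZ c kap : deg (c *: kap) = c * deg kap.
Proof. by rewrite /deg mulr_sumr; apply: eq_bigr => q _; rewrite mxE. Qed.

Lemma deg_delta q : deg (delta_mx 0 q) = 1.
Proof.
rewrite /deg (bigD1 q) //= big1 ?mxE ?eqxx ?addr0 // => p /negPf pq.
by rewrite mxE eqxx pq.
Qed.

Lemma expcoE lam kap : expco lam kap = \prod_(q < 4) exp_co (lam 0 q)%:~R (kap 0 q).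
Proof.
rewrite /expco; case: ifP => [/forallP kap0|/negbT/forallPn [q kapq]].
  by apply: eq_bigr => q _; rewrite /exp_co kap0.
by rewrite (bigD1 q) //= /exp_co (negPf kapq) mul0r.
Qed.

Lemma expco_ge0 lam kap : expco lam kap != 0 -> forall q, 0 <= kap 0 q.
Proof. by rewrite /expco; case: ifP => [/forallP|]; rewrite ?eqxx. Qed.

Lemma expco_der lam kap q :
  (kap 0 q + 1)%:~R * expco lam (kap + delta_mx 0 q) = (lam 0 q)%:~R * expco lam kap.
Proof.
rewrite [in LHS]expcoE [in RHS]expcoE [in LHS](bigD1 q) //= [in RHS](bigD1 q) //=.
rewrite [LHS]mulrA [RHS]mulrA; congr (_ * _); first by rewrite !mxE !eqxx exp_co_der.
by apply: eq_bigr => p /negPf pq; rewrite !mxE pq andbF addr0.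
Qed.

Lemma expco_pred lam kap q :
  (lam 0 q)%:~R * expco lam (kap - delta_mx 0 q) = (kap 0 q)%:~R * expco lam kap.
Proof. by rewrite -expco_der subrK !mxE !eqxx subrK. Qed.

(** Euler's relation for homogeneous parts, used below to raise the degree by one in inductions on
    powers of a linear form. *)
Lemma expco_euler lam kap :
  \sum_(q < 4) (lam 0 q)%:~R * expco lam (kap - delta_mx 0 q) =
  (deg kap)%:~R * expco lam kap.
Proof. by under eq_bigr do rewrite expco_pred; rewrite -mulr_suml rmorph_sum. Qed.

(** Indexing by finite functions lets a sum of products over the coordinates factor by
    [bigA_distr_bigA]. *)
Definition box (B : nat) : seq lin :=
  [seq \row_q (f q)%:Z | f : {ffun 'I_4 -> 'I_B}].

Lemma box_uniq B : uniq (box B).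
Proof.
rewrite map_inj_uniq ?enum_uniq // => f g /rowP fg; apply/ffunP => q.
by apply/val_inj; have := fg q; rewrite !mxE => -[].
Qed.

Lemma mem_box B kap : (kap \in box B) = [forall q, 0 <= kap 0 q < B%:Z].
Proof.
apply/mapP/forallP => [[f _ ->] q|h]; first by rewrite mxE ltz_nat ltn_ord.
have h' q : (absz (kap 0%R q) < B)%N by have := h q; lia.
exists [ffun q => Ordinal (h' q)]; first by rewrite mem_enum.
by apply/rowP => q; rewrite !mxE ffunE /=; have := h q; lia.
Qed.

Lemma fsum_box (V : zmodType) B (F : lin -> V) :
  (forall kap, ~~ [forall q, 0 <= kap 0 q < B%:Z] -> F kap = 0) ->
  \sum_(kap \in @setT lin) F kap = \sum_(kap <- box B) F kap.
Proof.
by move=> F0; apply: fsum_seq (box_uniq B) _ => kap; rewrite mem_box; apply: F0.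
Qed.

Lemma big_box (V : zmodType) B (F : lin -> V) :
  \sum_(kap <- box B) F kap = \sum_(f : {ffun 'I_4 -> 'I_B}) F (\row_q (f q)%:Z).
Proof. by rewrite big_map big_enum. Qed.

Definition size1 (kap : lin) : nat := (\sum_(q < 4) absz (kap 0%R q))%N.

Lemma size1_ge kap q : kap 0 q <= (size1 kap)%:Z.
Proof.
have : (absz (kap 0%R q) <= size1 kap)%N by rewrite /size1 (bigD1 q) //= leq_addr.
by lia.
Qed.

Lemma expco_conv lam mu : smul4 (expco lam) (expco mu) =1 expco (lam + mu).
Proof.
move=> kap; rewrite /smul4 (@fsum_box _ (size1 kap).+1); last first.
  move=> iot; apply: contraNeq; rewrite mulf_eq0 negb_or => /andP[/expco_ge0 i0 /expco_ge0 i1].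
  apply/forallP => q; have := i0 q; have := i1 q; have := size1_ge kap q; rewrite !mxE.
  by move: (iot 0 q) (kap 0 q) => a b; lia.
rewrite big_box expcoE.
under [RHS]eq_bigr => q _.
  rewrite !mxE rmorphD /= -(@exp_co_conv _ _ _ (size1 kap).+1); last first.
    by have := size1_ge kap q; lia.
  over.
rewrite bigA_distr_bigA; apply: eq_bigr => f _.
by rewrite !expcoE -big_split; apply: eq_bigr => q _; rewrite !mxE.
Qed.

(* Expansions leading with [y1] have arbitrarily negative powers of [y1], but only  *)
(* nonnegative powers of [y2, y3, y4] and total degree bounded below. *)
Definition tame (f : ser4) (d : nat) :=
  forall kap, f kap != 0 -> (forall q, q != 0 -> 0 <= kap 0 q) /\ - d%:Z <= deg kap.

(** The exponents of [y2], [y3], [y4] in [iot] are bounded by those of [kap]. For [y1] the bound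
    comes from the degree: [deg iot] is at most [deg kap + d], and all coordinates of [iot] are
    nonnegative. *)
Lemma tame_box f d kap iot : tame f d ->
  (forall q, 0 <= iot 0 q) -> f (kap - iot) != 0 ->
  iot \in box (size1 kap + d).+1.
Proof.
move=> tf i0 /tf [ki0 dk]; rewrite mem_box; apply/forallP => q; rewrite i0 /=.
have [->|q0] := eqVneq q 0; last first.
  by have := ki0 _ q0; have := size1_ge kap q; rewrite !mxE; move: (iot 0 q) (kap 0 q) => a b;
      lia.
move: dk; rewrite degD degN.
have dle : deg kap <= (size1 kap)%:Z.
  by rewrite /deg /size1 !big_ord_recl !big_ord0; lia.
have : iot 0 0 <= deg iot.
  by rewrite /deg (bigD1 0) //= lerDl sumr_ge0.
by lia.
Qed.

Lemma expco_conv_assoc lam mu f d : tame f d ->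
  smul4 (expco lam) (smul4 (expco mu) f) =1 smul4 (expco (lam + mu)) f.
Proof.
move=> tf kap; rewrite /smul4.
rewrite (@fconv_assoc _ _ _ _ _ _ (box (size1 kap + d).+1)).
- by apply: eq_fsbigr => iot _; rewrite -expco_conv.
- exact: box_uniq.
- move=> i j /expco_ge0 j0 /expco_ge0 ij0 fki.
  have i0 q : 0 <= i 0 q.
    by have := j0 q; have := ij0 q; rewrite !mxE; move: (i 0 q) (j 0 q) => a b; lia.
  have ib := tame_box tf i0 fki; rewrite ib /=.
  move: ib; rewrite !mem_box => /forallP ib; apply/forallP => q.
  by have := ib q; have := j0 q; have := ij0 q; rewrite !mxE; move: (i 0 q) (j 0 q) => a b; lia.
Qed.

(** * Powers of linear forms *)

Lemma CC_intr_neq0 (n : int) : n != 0 -> (n%:~R : CC) != 0.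
Proof.
by case: n => [[|n]|n] // _; rewrite ?NegzE ?mulrNz ?oppr_eq0 CC_natr_neq0.
Qed.

Lemma exp_co0 j : exp_co 0 j = (j == 0)%:R.
Proof.
case: j => [[|n]|n] //; first by rewrite exp_co_nat expr0 fact0 divr1.
by rewrite exp_co_nat expr0n mul0r.
Qed.

Lemma expco_eq0 lam kap q : lam 0 q = 0 -> expco lam kap != 0 -> kap 0 q = 0.
Proof.
move=> lamq; rewrite expcoE (bigD1 q) //= lamq mulf_eq0 negb_or exp_co0 => /andP[].
by have [-> //|_] := eqVneq (kap 0 q) 0; rewrite /= eqxx.
Qed.

Lemma deg_ge kap q : (forall p, 0 <= kap 0 p) -> kap 0 q <= deg kap.
Proof. by move=> k0; rewrite /deg (bigD1 q) //= lerDl sumr_ge0. Qed.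

Lemma expco_deg lam kap : expco lam kap != 0 -> 0 <= deg kap.
Proof. by move=> /expco_ge0 k0; apply: sumr_ge0. Qed.

Lemma expco0 lam : expco lam 0 = 1.
Proof. by rewrite expcoE big1 // => q _; rewrite mxE exp_co_nat expr0 fact0 divr1. Qed.

Lemma expco_intZ (c : int) lam kap :
  expco (c *: lam) kap = c%:~R ^+ absz (deg kap) * expco lam kap.
Proof.
rewrite /expco; case: ifP => [/forallP k0|_]; last by rewrite mulr0.
have -> : c%:~R ^+ absz (deg kap) = \prod_(q < 4) (c%:~R : CC) ^+ absz (kap 0 q).
  rewrite prodrXr; congr (_ ^+ _); apply/eqP; rewrite -eqz_nat.
  rewrite gez0_abs ?sumr_ge0 // -natz natr_sum /deg.
  by apply/eqP/eq_bigr => q _; rewrite natz gez0_abs.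
rewrite -big_split /=; apply: eq_bigr => q _.
by rewrite mxE rmorphM exprMn mulrA.
Qed.

(** The falling factorial at an integer of either sign; [gbin j i] is [ffact j i] divided by
    [i!]. *)
Definition ffact (x : int) (n : nat) : CC := \prod_(t < n) (x - t%:Z)%:~R.

Lemma ffactS x n : ffact x n.+1 = ffact x n * (x - n%:Z)%:~R.
Proof. by rewrite /ffact big_ord_recr. Qed.

Lemma ffactSS x n : ffact (x + 1) n.+1 = (x + 1)%:~R * ffact x n.
Proof.
rewrite /ffact big_ord_recl subr0; congr (_ * _); apply: eq_bigr => t _.
by congr (_%:~R); rewrite lift0; lia.
Qed.

(** Pascal's rule for [gbin], multiplied by the factorial of [n + 1]. *)
Lemma ffact_pascal x n : ffact (x + 1) n.+1 = ffact x n.+1 + n.+1%:R * ffact x n.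
Proof.
rewrite ffactSS ffactS mulrC [n.+1%:R * _]mulrC -mulrDr; congr (_ * _).
by rewrite -[n.+1%:R]/(n.+1%:~R) -rmorphD /=; congr (_%:~R); lia.
Qed.

Definition ltail l : lin := l - l 0 0 *: delta_mx 0 0.

Lemma ltailE l q : ltail l 0 q = if q == 0 then 0 else l 0 q.
Proof. by rewrite !mxE /=; case: eqVneq => [->|_]; rewrite ?mulr1 ?mulr0 ?subrr ?subr0. Qed.

Lemma fstv_ord0 l : l 0 0 != 0 -> fstv l = 0.
Proof.
move=> l0; rewrite /fstv; case: pickP => [p /andP[lp /forallP h]|/(_ 0)]; last first.
  by rewrite l0 /= => /negbT /forallPn [].
apply/eqP; apply: contraNT l0 => p0; have := h 0.
by rewrite lt0n p0.
Qed.

Lemma smul4_rest l f kap : l 0 0 != 0 ->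
  smul4 (rest l) f kap = \sum_(q < 4) (ltail l 0 q)%:~R * f (kap - delta_mx 0 q).
Proof.
move=> l0; have restE iot : rest l iot = \sum_(q < 4) (ltail l 0 q)%:~R * (iot == delta_mx 0
    q)%:R.
  rewrite /rest fstv_ord0 // [LHS]big_mkcond; apply: eq_bigr => q _.
  by rewrite ltailE; case: eqVneq; rewrite // mul0r.
have delta_box q : delta_mx 0 q \in box 2.
  by rewrite mem_box; apply/forallP => p; rewrite mxE eqxx /=; case: eqP.
rewrite /smul4 (@fsum_box _ 2); last first.
  move=> iot iotB; rewrite restE big1 ?mul0r // => q _.
  suff -> : iot == delta_mx 0 q = false by rewrite mulr0.
  by apply: contraNF iotB => /eqP ->; rewrite -mem_box.
under eq_bigr do rewrite restE mulr_suml.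
rewrite exchange_big /=; apply: eq_bigr => q _.
rewrite (bigD1_seq (delta_mx 0 q)) ?box_uniq //= eqxx mulr1 big1 ?addr0 //.
by move=> iot /negPf ->; rewrite mulr0 mul0r.
Qed.

(** The multinomial theorem in exponential form: the [i]-th power of a linear form is [i!] times the
    degree [i] part of its exponential. The induction step is Euler's relation. *)
Lemma spow4_rest l i kap : l 0 0 != 0 ->
  spow4 (rest l) i kap = (i`!%:R * expco (ltail l) kap) *+ (deg kap == i%:Z).
Proof.
move=> l0; elim: i kap => [|i IHi] kap.
  rewrite fact0 mul1r /spow4 /= /one4; have [->|kn0] := eqVneq kap 0.
    by rewrite expco0 /deg big1 ?eqxx // => q _; rewrite mxE.
  have [d0|//] := eqVneq (deg kap) 0; rewrite mulr1n; apply/esym.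
  apply: contraNeq kn0 => /expco_ge0 k0; apply/eqP/rowP => q; rewrite mxE.
  by apply/eqP; rewrite eq_le k0 -d0 deg_ge.
rewrite /spow4 iterS -/(spow4 _ _) smul4_rest //.
under eq_bigr do rewrite IHi -mulrnAl mulrA [_ * (_ *+ _)]mulrC -mulrA degD degN deg_delta.
rewrite -mulr_sumr expco_euler.
have -> : (deg kap - 1 == i%:Z) = (deg kap == i.+1%:Z) by lia.
case: eqVneq => [->|_]; last by rewrite !mulr0n mul0r.
by rewrite !mulr1n mulrA factS natrM; congr (_ * _); rewrite mulrC.
Qed.

(* the coefficient of [y ^ kap] in the expansion of [l ^ (deg kap)], leading with [y1] *)
Definition lpow_co l kap : CC :=
  ffact (deg kap) (absz (deg kap - kap 0 0)%R) * (l 0 0)%:~R ^ (kap 0 0) *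
  expco (ltail l) (kap - kap 0 0 *: delta_mx 0 0).

Lemma deg_drop0 kap : deg (kap - kap 0 0 *: delta_mx 0 0) = deg kap - kap 0 0.
Proof. by rewrite degD degN degZ deg_delta mulr1. Qed.

Lemma lpow_co_ge0 l kap : lpow_co l kap != 0 -> forall q, q != 0 -> 0 <= kap 0 q.
Proof.
rewrite /lpow_co mulf_eq0 negb_or => /andP[_ /expco_ge0 k0] q q0.
by have := k0 q; rewrite !mxE (negPf q0) mulr0 subr0.
Qed.

(** At a given [kap], only the binomial term whose power of [y1] is [kap 0 0] can contribute, since
    [ltail l] does not contain [y1]. *)
Lemma lpowE l j kap : l 0 0 != 0 -> lpow l j kap = lpow_co l kap *+ (deg kap == j).
Proof.
move=> l0; rewrite /lpow (fstv_ord0 l0).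
pose F (i : nat) := gbin j i * (l 0 0)%:~R ^ (j - i%:Z) *
  spow4 (rest l) i (kap - (j - i%:Z) *: delta_mx 0 0).
change (\sum_(i \in @setT nat) F i = lpow_co l kap *+ (deg kap == j)).
have FE i : F i = ffact j i * (l 0 0)%:~R ^ (j - i%:Z) *
    expco (ltail l) (kap - (j - i%:Z) *: delta_mx 0 0) *+ (deg kap == j).
  rewrite /F spow4_rest // degD degN degZ deg_delta mulr1.
  have -> : (deg kap - (j - i%:Z) == i%:Z) = (deg kap == j) by lia.
  rewrite mulrnAr; congr (_ *+ _); rewrite /gbin -/(ffact j i).
  by have f0 := CC_fact_neq0 i; rewrite mulrA; congr (_ * _); rewrite mulrAC divfK.
have [dj|dj] := eqVneq (deg kap) j; last first.
  by rewrite fsbig1 // => i _; rewrite FE (negPf dj).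
have Fi i : F i != 0 -> kap 0 0 = j - i%:Z.
  rewrite FE -dj eqxx mulr1n mulf_eq0 negb_or => /andP[_ /(@expco_eq0 _ _ 0)].
  by rewrite ltailE eqxx !mxE !eqxx mulr1 => /(_ erefl) /subr0_eq ->.
(* If [deg kap < kap 0 0] no index [i] exists, and [lpow_co] is zero as well because its exponential
   factor is taken in negative degree. *)
rewrite mulr1n; have [i0|i0] := leP 0 (deg kap - kap 0 0).
  rewrite (@fsum_single _ _ (absz (deg kap - kap 0 0)%R)); last first.
    by move=> i /Fi; lia.
  rewrite FE -dj eqxx mulr1n /lpow_co.
  by have -> : deg kap - (absz (deg kap - kap 0 0)%R)%:Z = kap 0 0 by lia.
rewrite fsbig1; last by move=> i _; apply/eqP; apply: contraLR i0 => /Fi; lia.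
rewrite /lpow_co; apply/esym; apply: contraTeq i0; rewrite mulf_eq0 negb_or => /andP[_
    /expco_deg].
by rewrite deg_drop0 -leNgt.
Qed.

(** The chain rule for [l ^ j] with [j = deg kap + 1]. *)
Lemma lpow_co_der l kap q : l 0 0 != 0 ->
  (kap 0 q + 1)%:~R * lpow_co l (kap + delta_mx 0 q) =
  (l 0 q)%:~R * ((deg kap + 1)%:~R * lpow_co l kap).
Proof.
move=> l0; rewrite {1}/lpow_co degD deg_delta mxE.
have l0' := CC_intr_neq0 l0.
have [->|q0] := eqVneq q 0.
  rewrite mxE /=.
  have -> : deg kap + 1 - (kap 0 0 + 1) = deg kap - kap 0 0 by lia.
  have -> : kap + delta_mx 0 0 - (kap 0 0 + 1) *: delta_mx 0 0 =
    kap - kap 0 0 *: delta_mx 0 0.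
    by rewrite scalerDl scale1r opprD addrACA addrN addr0 addrC.
  rewrite /lpow_co; set e := expco _ _; have [->|e0] := eqVneq e 0; first by rewrite !mulr0.
  have := expco_deg e0; rewrite deg_drop0 => d0.
  rewrite exprzDr ?unitfE // expr1z.
  have -> : (kap 0 0 + 1) = deg kap + 1 - (absz (deg kap - kap 0 0)%R)%:Z by lia.
  rewrite !mulrA [_%:~R * ffact _ _]mulrC -ffactS ffactSS.
  by ring.
rewrite mxE /= (eq_sym 0 q) (negPf q0) addr0.
have -> : kap + delta_mx 0 q - kap 0 0 *: delta_mx 0 0 =
  (kap - kap 0 0 *: delta_mx 0 0) + delta_mx 0 q by rewrite addrAC.
rewrite mulrCA.
have := expco_der (ltail l) (kap - kap 0 0 *: delta_mx 0 0) q.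
rewrite (_ : (kap - kap 0 0 *: delta_mx 0 0) 0 q = kap 0 q); last first.
  by rewrite !mxE (negPf q0) andbF mulr0 subr0.
rewrite ltailE (negPf q0) => ->.
rewrite /lpow_co; set e := expco _ (kap - _); have [->|e0] := eqVneq e 0; first by rewrite !mulr0.
have := expco_deg e0; rewrite deg_drop0 => d0.
have -> : absz (deg kap + 1 - kap 0 0)%R = (absz (deg kap - kap 0 0)%R).+1 by lia.
by rewrite ffactSS; ring.
Qed.

(** This is [l * l ^ (j - 1) = l ^ j] for the expanded powers, with [j = deg kap]; it reduces to
    Pascal's rule. *)
Lemma lpow_co_pascal l kap : l 0 0 != 0 ->
  \sum_(q < 4) (l 0 q)%:~R * lpow_co l (kap - delta_mx 0 q) = lpow_co l kap.
Proof.
move=> l0.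
have l0' := CC_intr_neq0 l0.
pose kap' := kap - kap 0 0 *: delta_mx 0 0; pose e := expco (ltail l) kap'.
pose a := ((l 0 0)%:~R : CC) ^ (kap 0 0); pose i := deg kap - kap 0 0.
have -> : lpow_co l kap = ffact (deg kap) (absz i) * a * e by [].
rewrite (bigD1 0) //=.
have -> : (l 0 0)%:~R * lpow_co l (kap - delta_mx 0 0) = ffact (deg kap - 1) (absz i) * a * e.
  rewrite /lpow_co degD degN deg_delta !mxE /=.
  have -> : deg kap - 1 - (kap 0 0 - 1) = i by rewrite /i; lia.
  have -> : kap - delta_mx 0 0 - (kap 0 0 - 1) *: delta_mx 0 0 = kap'.
    by rewrite scalerBl scale1r opprB addrA subrK.
  by rewrite /a exprzDr ?unitfE // exprN1 -/e; field.
have q_neq0 q : q != 0 -> (l 0 q)%:~R * lpow_co l (kap - delta_mx 0 q) =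
   ffact (deg kap - 1) (absz (i - 1)%R) * a * ((ltail l 0 q)%:~R * expco (ltail l) (kap' -
       delta_mx 0 q)).
  move=> q0; rewrite /lpow_co degD degN deg_delta ltailE (negPf q0).
  have -> : (kap - delta_mx 0 q) 0 0 = kap 0 0 by rewrite !mxE eq_sym (negPf q0) andbF subr0.
  have -> : deg kap - 1 - kap 0 0 = i - 1 by rewrite /i; lia.
  have -> : kap - delta_mx 0 q - kap 0 0 *: delta_mx 0 0 = kap' - delta_mx 0 q.
    by rewrite addrAC.
  by rewrite -/a; ring.
rewrite (eq_bigr _ q_neq0) -mulr_sumr.
have -> : \sum_(q < 4 | q != 0) (ltail l 0 q)%:~R * expco (ltail l) (kap' - delta_mx 0 q) =
    i%:~R * e.
  by rewrite /i -deg_drop0 -/kap' -expco_euler [RHS](bigD1 0) //= ltailE eqxx mul0r add0r.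
have [->|e0] := eqVneq e 0; first by rewrite !mulr0 addr0.
have := expco_deg e0; rewrite deg_drop0 -/i; clear q_neq0; case: i => [[|n]|n] // _.
  by rewrite mul0r mulr0 addr0 /ffact !big_ord0.
have -> : absz (n.+1%:Z - 1)%R = n by lia.
have -> : ffact (deg kap) (absz n.+1) = ffact (deg kap - 1 + 1) n.+1 by rewrite subrK.
by rewrite ffact_pascal /=; ring.
Qed.

(** Both [l] and [- l] are expanded with [y1] leading, so they differ by a sign only and no delta
    function appears. *)
Lemma lpow_co_opp l kap : l 0 0 != 0 -> lpow_co (- l) kap = (-1) ^ (deg kap) * lpow_co l kap.
Proof.
move=> l0; have l0' := CC_intr_neq0 l0; rewrite /lpow_co; have -> : ltail (- l) = (-1) *: ltail l.
  by rewrite /ltail mxE scaleNr scaleN1r opprB opprK addrC.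
rewrite expco_intZ deg_drop0; set e := expco _ _.
have [->|e0] := eqVneq e 0; first by rewrite !mulr0.
have := expco_deg e0; rewrite deg_drop0 => d0.
have -> : (-1) ^ deg kap = (-1) ^ (kap 0 0) * (-1) ^+ absz (deg kap - kap 0 0)%R :> CC.
  have <- : (-1) ^ (deg kap - kap 0 0) = (-1) ^+ absz (deg kap - kap 0 0)%R :> CC.
    by rewrite -{1}[deg kap - kap 0 0]gez0_abs.
  rewrite -exprzDr; first by congr (_ ^ _); rewrite addrC subrK.
  by rewrite unitrN1.
have -> : ((- l) 0 0)%:~R = -1 * (l 0 0)%:~R :> CC by rewrite mxE mulrNz mulN1r.
rewrite exprzMl ?unitrN1 ?unitfE //.
have -> : (-1)%:~R = -1 :> CC by rewrite mulrNz.
by ring.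
Qed.

(** The degree [j] part of [exp (l)] is [l ^ j / j!]; the induction strips off one factor [l] at a
    time with [lpow_co_pascal]. *)
Lemma lpow_co_conv_deg l (j : nat) kap : l 0 0 != 0 ->
  \sum_(iot \in @setT lin) (expco l iot *+ (deg iot == j%:Z)) * lpow_co l (kap - iot) =
  lpow_co l kap / j`!%:R.
Proof.
move=> l0; have inbox (i : nat) iot (x : CC) :
    ~~ [forall q, 0 <= iot 0 q < i.+1%:Z] -> (expco l iot *+ (deg iot == i%:Z)) * x = 0.
  move=> iotb; apply/eqP; rewrite mulf_eq0; apply/orP; left.
  apply: contraNT iotb; have [di|_] := eqVneq (deg iot) i; last by rewrite mulr0n eqxx.
  rewrite mulr1n => /expco_ge0 i0; apply/forallP => q; rewrite i0 /=.
  by apply: le_lt_trans (deg_ge q i0) _; rewrite di ltz_nat.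
elim: j kap => [|j IHj] kap.
  rewrite (@fsum_single _ _ 0); last first.
    move=> iot; apply: contraNeq => iot0; rewrite inbox //.
    apply: contra iot0 => /forallP h; apply/eqP/rowP => q; have := h q; rewrite mxE.
    by move: (iot 0 q) => a; lia.
  by rewrite expco0 /deg big1 ?eqxx ?mul1r ?subr0 ?fact0 ?divr1 // => q _; rewrite mxE.
apply: (mulfI (CC_natr_neq0 j)).
rewrite factS natrM invfM mulrCA [_ * (_^-1 * _)]mulrA divff ?mul1r ?CC_natr_neq0 //.
rewrite (@fsum_box _ j.+2) ?mulr_sumr; last by move=> iot; apply: inbox.
(* Euler's relation writes [j + 1] times the degree [j + 1] part of the exponential as [l] times its
   degree [j] part. *)
transitivity (\sum_(iot <- box j.+2) \sum_(q < 4)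
   (l 0 q)%:~R * ((expco l (iot - delta_mx 0 q) *+ (deg (iot - delta_mx 0 q) == j%:Z)) *
       lpow_co l (kap - iot))).
  apply: eq_bigr => iot _.
  under [RHS]eq_bigr => q _.
    rewrite degD degN deg_delta (_ : (deg iot - 1 == j%:Z) = (deg iot == j.+1%:Z)); last by lia.
    rewrite mulrA.
    over.
  rewrite -mulr_suml mulrA; congr (_ * _); case: eqVneq => [di|_]; last first.
    by rewrite mulr0n mulr0 big1 // => q _; rewrite mulr0.
  by under eq_bigr do rewrite mulr1n; rewrite expco_euler di mulr1n.
rewrite exchange_big /= -(lpow_co_pascal kap l0) mulr_suml; apply: eq_bigr => q _.
rewrite -mulrA -mulr_sumr; congr (_ * _).
rewrite -IHj -(@fsum_box _ j.+2); last first.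
  move=> iot; apply: contraNeq; rewrite mulf_eq0 negb_or => /andP[iot0 _].
  have : iot - delta_mx 0 q \in box j.+1.
    rewrite mem_box; apply: contraNT iot0 => h.
    by have := inbox _ _ 1 h; rewrite mulr1 => ->.
  rewrite mem_box => /forallP h; apply/forallP => p; have := h p; rewrite !mxE eqxx /=.
  by move: (iot 0 p) => a; case: eqP => _; lia.
rewrite [LHS](fsum_shift (delta_mx 0 q)).
by apply: eq_fsbigr => iot _; rewrite addrK opprD addrA -addrAC.
Qed.

(* product of [exp (q t)] with the Laurent series [c] *)
Definition exp_mul (q : CC) (c : int -> CC) (n : int) : CC :=
  \sum_(i \in @setT int) exp_co q i * c (n - i).

Definition low_order (d : nat) (c : int -> CC) := forall n, n < - d%:Z -> c n = 0.

Lemma exp_mulE d (B : nat) q c n : low_order d c -> n + d%:Z < B%:Z ->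
  exp_mul q c n = \sum_(i < B) exp_co q i%:Z * c (n - i%:Z).
Proof.
move=> lc hB; apply: fsum_nat => m; apply: contraNeq.
rewrite mulf_eq0 negb_or => /andP[/exp_co_ge0 -> cn] /=.
by rewrite ltNge; apply: contra cn => mB; rewrite lc //; lia.
Qed.

(* the substitution [t := l] into the Laurent series [c] *)
Definition lsubst l (c : int -> CC) : ser4 := fun kap => c (deg kap) * lpow_co l kap.

Lemma lsubst_tame l c d : low_order d c -> tame (lsubst l c) d.
Proof.
move=> lc kap; rewrite /lsubst mulf_eq0 negb_or => /andP[cd /lpow_co_ge0 k0]; split => //.
by rewrite leNgt; apply: contra cd => h; rewrite lc.
Qed.

(** Substitution of [l] for [t] respects multiplication by exponentials. The exponential is split by
    degree and each part is handled by [lpow_co_conv_deg]. *)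
Lemma expco_lsubst (q : int) l c d : l 0 0 != 0 -> low_order d c ->
  smul4 (expco (q *: l)) (lsubst l c) =1 lsubst l (exp_mul q%:~R c).
Proof.
move=> l0 lc kap; pose J := (absz (deg kap) + d).+1.
have iot_box iot (x : CC) : ~~ [forall p, 0 <= iot 0 p < J%:Z] ->
    (deg iot < J%:Z) -> expco l iot * x = 0.
  move=> iotb dJ; apply/eqP; rewrite mulf_eq0; apply/orP; left.
  apply: contraNT iotb => /expco_ge0 i0; apply/forallP => p; rewrite i0 /=.
  exact: le_lt_trans (deg_ge p i0) dJ.
pose G iot (j : nat) : CC := (expco l iot *+ (deg iot == j%:Z)) * lpow_co l (kap - iot).
(* A redundant sum over the degree [j] of [iot] is inserted, so that exchanging the sums isolates
   the homogeneous parts. *)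
transitivity (\sum_(iot <- box J) \sum_(j < J) q%:~R ^+ j * c (deg kap - j%:Z) * G iot j).
  rewrite /smul4 (@fsum_box _ J); last first.
    move=> iot iotb; rewrite expco_intZ -mulrA mulrCA.
    have [dJ|dJ] := ltP (deg iot) J; first by rewrite iot_box.
    by rewrite /lsubst degD degN lc ?mul0r ?mulr0 //; rewrite /J in dJ; lia.
  apply: eq_bigr => iot _; rewrite expco_intZ /lsubst degD degN.
  have [e0|e0] := eqVneq (expco l iot) 0.
    by rewrite e0 mulr0 mul0r big1 // => j _; rewrite /G e0 mul0rn mul0r mulr0.
  have d0 := expco_deg e0.
  have [dJ|dJ] := ltP (absz (deg iot)) J; last first.
    rewrite lc ?mul0r ?mulr0 ?big1 //; last by rewrite /J in dJ; lia.
    move=> j _; rewrite /G (_ : deg iot == j = false) ?mulr0n ?mul0r ?mulr0 //.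
    by apply/negP => /eqP; have := ltn_ord j; lia.
  rewrite (bigD1 (Ordinal dJ)) //= big1 ?addr0.
    by rewrite /G gez0_abs // eqxx mulr1n; ring.
  move=> j jn; rewrite /G (_ : deg iot == j = false) ?mulr0n ?mul0r ?mulr0 //.
  by apply/negP => /eqP dj; case/eqP: jn; apply/val_inj => /=; lia.
rewrite exchange_big /= /lsubst (@exp_mulE d J) //; last by rewrite /J; lia.
rewrite mulr_suml; apply: eq_bigr => j _; rewrite -mulr_sumr.
rewrite -(@fsum_box _ J); last first.
  move=> iot iotb; rewrite /G; case: eqVneq => [dj|_]; last by rewrite mulr0n mul0r.
  by rewrite mulr1n iot_box // dj ltz_nat.
by rewrite lpow_co_conv_deg // exp_co_nat; ring.
Qed.

(** * Laurent series in one variable *)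

Section LaurentSeries.
Implicit Types (c : int -> CC) (n m M : int).

Definition lder c n : CC := (n + 1)%:~R * c (n + 1).
Definition delta0 n : CC := (n == 0)%:R.

Lemma low_order_lder d c : low_order d c -> low_order d.+1 (lder c).
Proof. by move=> lc n hn; rewrite /lder lc ?mulr0 //; lia. Qed.

Lemma low_orderW d d' c : (d <= d')%N -> low_order d c -> low_order d' c.
Proof. by move=> dd lc n hn; apply: lc; lia. Qed.

Lemma low_order_exp_mul d q c : low_order d c -> low_order d (exp_mul q c).
Proof. by move=> lc n hn; rewrite (@exp_mulE d 0) ?big_ord0 //; lia. Qed.

Lemma exp_mul_comp d p q c n : low_order d c -> exp_mul p (exp_mul q c) n = exp_mul (p + q) c n.
Proof.
move=> lc; rewrite /exp_mul (@fconv_assoc _ _ _ _ _ _ (irange (absz n + d))).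
- apply: eq_fsbigr => i _; congr (_ * _).
  rewrite (@fsum_nat _ (absz i).+1) ?exp_co_conv //; first by lia.
  move=> j; apply: contraNeq; rewrite mulf_eq0 negb_or => /andP[/exp_co_ge0 j0 /exp_co_ge0].
  by lia.
- exact: irange_uniq.
- move=> i j /exp_co_ge0 j0 /exp_co_ge0 ij0 ci; rewrite !mem_irange.
  have : - d%:Z <= n - i by rewrite leNgt; apply: contra ci => h; rewrite lc.
  by lia.
Qed.

Lemma exp_mul_der d q c n : low_order d c -> lder (exp_mul q c) n = q * exp_mul q c n + exp_mul
    q (lder c) n.
Proof.
move=> lc; pose B := (absz n + d).+1.
rewrite /lder (@exp_mulE d B.+1) //; last by rewrite /B; lia.
rewrite (@exp_mulE d B) //; last by rewrite /B; lia.
rewrite (@exp_mulE d.+1 B.+1); [|exact: low_order_lder|by rewrite /B; lia].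
(* The Leibniz rule: [n + 1] is split as [i + (n + 1 - i)]. *)
transitivity (\sum_(i < B.+1) i%:~R * exp_co q i%:Z * c (n + 1 - i%:Z) +
              \sum_(i < B.+1) exp_co q i%:Z * lder c (n - i%:Z)).
  rewrite mulr_sumr -big_split; apply: eq_bigr => i _ /=; rewrite /lder.
  have -> : n - i%:Z + 1 = n + 1 - i%:Z by lia.
  by rewrite [(n + 1 - _)%:~R]rmorphB /=; ring.
congr (_ + _); rewrite big_ord_recl /= !mul0r add0r mulr_sumr; apply: eq_bigr => i _.
have -> : bump 0 i = i.+1 by [].
rewrite mulrA -exp_co_der.
have -> : n + 1 - i.+1%:Z = n - i%:Z by lia.
by have -> : i%:Z + 1 = i.+1%:Z by lia.
Qed.

Lemma exp_mul_linear d q (a : CC) c1 c2 n : low_order d c1 -> low_order d c2 ->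
  exp_mul q (fun n => c1 n + a * c2 n) n = exp_mul q c1 n + a * exp_mul q c2 n.
Proof.
move=> l1 l2; have hB : n + d%:Z < (absz n + d).+1%:Z by lia.
rewrite (exp_mulE _ l1 hB) (exp_mulE _ l2 hB) (@exp_mulE d _ _ _ _ _ hB); last first.
  by move=> m hm; rewrite l1 // l2 // mulr0 addr0.
by rewrite mulr_sumr -big_split; apply: eq_bigr => i _ /=; ring.
Qed.

Lemma eq_exp_mul q c1 c2 n : c1 =1 c2 -> exp_mul q c1 n = exp_mul q c2 n.
Proof. by move=> c12; apply: eq_fsbigr => i _; rewrite c12. Qed.

Lemma exp_mul0 c n : exp_mul 0 c n = c n.
Proof.
rewrite /exp_mul (@fsum_single _ _ 0) ?exp_co0 ?mul1r ?subr0 // => i.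
by rewrite exp_co0; apply: contraNeq => /negPf ->; rewrite mul0r.
Qed.

Lemma exp_mul_delta0 q n : exp_mul q delta0 n = exp_co q n.
Proof.
rewrite /exp_mul (@fsum_single _ _ n) ?subrr ?/delta0 ?eqxx ?mulr1 // => i.
by apply: contraNeq => ni; rewrite /delta0 (_ : (n - i == 0) = false) ?mulr0 //; lia.
Qed.

Lemma low_order_delta0 : low_order 0 delta0.
Proof. by move=> n hn; rewrite /delta0 (_ : n == 0 = false) //; lia. Qed.

Lemma FcoS (n : nat) : Fco n.+1 = - \sum_(i < n.+1) uco (n.+1 - i) * Fco i.
Proof.
have szF k : size (Fseq k) = k.+1 by elim: k => //= k IH; rewrite size_rcons IH.
have nthF k i : (i <= k)%N -> (Fseq k)`_i = Fco i.
  elim: k => [|k IH]; first by rewrite leqn0 => /eqP ->.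
  rewrite leq_eqVlt => /orP[/eqP -> //|ik]; rewrite /= nth_rcons szF ik IH //.
by rewrite {1}/Fco /= nth_rcons szF ltnn eqxx; congr (- _); apply: eq_bigr => i _; rewrite nthF
    // -ltnS.
Qed.

Lemma low_order_gco : low_order 1 gco.
Proof. by move=> n hn; rewrite /gco ifF //; lia. Qed.

Lemma gco_nat (n : nat) : gco (n%:Z - 1) = Fco n.
Proof. by rewrite /gco subrK. Qed.

(* [g (t) (1 - exp (- t)) = 1] *)
Lemma gco_eq n : gco n - exp_mul (-1) gco n = delta0 n.
Proof.
have [n0|n0] := ltP n (-1).
  by rewrite low_order_gco // (low_order_exp_mul _ low_order_gco) // subr0 /delta0 (_ : n == 0
      = false) //; lia.
have [N ->] : exists N : nat, n = N%:Z - 1 by exists (absz (n + 1)); lia.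
rewrite (@exp_mulE 1 N.+1); [|exact: low_order_gco|by lia].
rewrite big_ord_recl /= subr0 exp_co_nat expr0 fact0 divr1 mul1r opprD addNKr -sumrN.
case: N => [|N]; first by rewrite big_ord0.
have -> : delta0 (N.+1%:Z - 1) = (N == 0%N)%:R by rewrite /delta0; congr (_%:R); lia.
(* The [i = 0] term has cancelled [gco n]. What is left of [1 - exp (- t)] is [t u (t)], hence a
   coefficient of [u F], which is zero in positive degree by the recursion for [Fco]. *)
transitivity (\sum_(i < N.+1) uco i * Fco (N - i)).
  apply: eq_bigr => i _; have -> : bump 0 i = i.+1 by [].
  rewrite exp_co_nat.
  have -> : N.+1%:Z - 1 - i.+1%:Z = (N - i)%N%:Z - 1 by have := ltn_ord i; lia.
  by rewrite gco_nat /uco exprS -mulNr; congr (_ * _); ring.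
have -> : \sum_(i < N.+1) uco i * Fco (N - i) = \sum_(i < N.+1) uco (N - i) * Fco i.
  rewrite (reindex_inj rev_ord_inj) /=; apply: eq_bigr => i _.
  by rewrite !subSS subKn // -ltnS.
have uco0 : uco 0 = 1 by rewrite /uco expr0 divr1.
rewrite big_ord_recr /= subnn uco0 mul1r.
by case: N => [|N]; rewrite ?big_ord0 ?add0r // FcoS subrr.
Qed.

(** As [1 - exp (- t)] begins with [t], once all coefficients of [c] below [n] vanish, the
    coefficient of [t ^ (n + 1)] in the product is [c n]. *)
Lemma exp_mul_fixed_eq0 d c : low_order d c -> (forall n, exp_mul (-1) c n = c n) -> forall n,
    c n = 0.
Proof.
move=> lc fix_c; suff h (N : nat) n : n < N%:Z - d%:Z -> c n = 0.
  by move=> n; apply: (h (absz n + d).+1); lia.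
elim: N n => [|N IHN] n hn; first by apply: lc; lia.
have [hn'|hn'] := ltP n (N%:Z - d%:Z); first exact: IHN.
have := fix_c (n + 1); rewrite /exp_mul (@fsum_nat _ 2); last first.
  move=> i; apply: contraNeq; rewrite mulf_eq0 negb_or => /andP[/exp_co_ge0 i0 ci]; rewrite i0 /=.
  by rewrite ltNge; apply: contra ci => hi; rewrite IHN //; lia.
rewrite !big_ord_recl big_ord0 /= subr0 addrK addr0 !exp_co_nat expr0 expr1 divr1 mul1r divr1
    mulN1r.
by move/eqP; rewrite -subr_eq0 addrAC subrr add0r oppr_eq0 => /eqP.
Qed.

Lemma signzB n (i : nat) : (-1) ^ (n - i%:Z) = (-1) ^ n * (-1) ^+ i :> CC.
Proof.
rewrite exprzDr ?unitrN1 // -exprz_inv invrN1; congr (_ * _).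
Qed.

(* [g (t) + g (- t) = 1] *)
Lemma gco_symm n : gco n + (-1) ^ n * gco n = delta0 n.
Proof.
pose gm n := (-1) ^ n * gco n; pose e n := gco n + 1 * gm n + (-1) * delta0 n.
have lg := low_order_gco; have lgm : low_order 1 gm by move=> k hk; rewrite /gm lg // mulr0.
have ldl : low_order 1 delta0 := low_orderW (leq0n 1) low_order_delta0.
(* Multiplying [g (1 - exp (- t)) = 1] by [exp (t)] gives [exp (t) g = g + exp (t)]; replacing [t]
   by [- t] yields the next identity, for [gm]. *)
have Exg k : exp_mul 1 gco k = gco k + exp_co 1 k.
  have := exp_mul_linear 1 (-1) k lg (low_order_exp_mul (-1) lg).
  rewrite (exp_mul_comp _ _ _ lg) subrr exp_mul0 (eq_exp_mul _ (c2 := delta0)); last first.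
    by move=> i; rewrite mulN1r gco_eq.
  by rewrite exp_mul_delta0 => ->; rewrite mulN1r addrC subrK.
have Exgm k : exp_mul (-1) gm k = gm k + exp_co (-1) k.
  have hk : k + 1%:Z < (absz k).+2%:Z by lia.
  transitivity ((-1) ^ k * exp_mul 1 gco k).
    rewrite (exp_mulE _ lgm hk) (exp_mulE _ lg hk) mulr_sumr; apply: eq_bigr => i _.
    rewrite /gm signzB !exp_co_nat expr1n.
    have s2 : (-1) ^+ i * (-1) ^+ i = 1 :> CC by rewrite -expr2 sqrr_sign.
    rewrite [LHS](_ : _ = ((-1) ^+ i * (-1) ^+ i) * ((-1) ^ k * (1 / i`!%:R * gco (k -
        i%:Z)))); first by rewrite s2 [LHS]mul1r.
    by ring.
  rewrite Exg mulrDr; congr (_ + _); case: k {hk} => [k|k]; last by rewrite /exp_co /= mulr0.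
  by rewrite !exp_co_nat expr1n -exprnP mulrA mulr1.
have le : low_order 1 e by move=> k hk; rewrite /e lg // lgm // ldl // !mulr0 !addr0.
(* The defect [e] of the claimed identity is fixed by [exp (- t)]: the two exponentials and the two
   units cancel. *)
have fix_e k : exp_mul (-1) e k = e k.
  have lgg : low_order 1 (fun k => gco k + 1 * gm k) by move=> j hj; rewrite lg // lgm // mulr0
      addr0.
  rewrite (exp_mul_linear _ _ _ lgg ldl) (exp_mul_linear _ _ _ lg lgm) Exgm exp_mul_delta0.
  have := gco_eq k; rewrite /e => /eqP; rewrite subr_eq => /eqP ->.
  by ring.
have := exp_mul_fixed_eq0 le fix_e n; rewrite /e /gm mul1r mulN1r => /eqP.
by rewrite subr_eq0 => /eqP.
Qed.

(** The derivative of [g (t) + g (- t) = 1], read coefficientwise. *)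
Lemma dgco_even n : (-1) ^ n * dgco n = dgco n.
Proof.
have := gco_symm (n + 1); rewrite exprzDr ?unitrN1 // expr1z => h.
have : (n + 1)%:~R * delta0 (n + 1) = 0.
  by rewrite /delta0; case: eqVneq => [->|_]; rewrite ?mul0r ?mulr0.
by rewrite -h /dgco => h'; apply/eqP; rewrite eq_sym -subr_eq0 -{}h'; apply/eqP; ring.
Qed.

(** Equal to 1 for [0 <= m < M], to -1 for [M <= m < 0], and to 0 otherwise: the signed sum from 0
    to [M] for either sign of [M]. *)
Definition step_diff M m : CC := (0 <= m)%R%:R - (M <= m)%R%:R.

Lemma gco_telescope (B : nat) M n : (absz M <= B)%N ->
  gco n - exp_mul (- M%:~R) gco n = \sum_(m <- irange B) step_diff M m * exp_co (- m%:~R) n.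
Proof.
have lg := low_order_gco.
pose T M := gco n - exp_mul (- M%:~R) gco n - \sum_(m <- irange B) step_diff M m * exp_co (-
    m%:~R) n.
(* Raising [k] by one adds [exp (- k t) g (1 - exp (- t)) = exp (- k t)] to the left side. This
   invariance is used upwards and downwards from [T 0]. *)
have stepT k : (absz k <= B)%N -> T (k + 1) = T k.
  move=> hk; have hE : exp_mul (- k%:~R) gco n - exp_mul (- (k + 1)%:~R) gco n = exp_co (-
      k%:~R) n.
    rewrite -exp_mul_delta0 -(eq_exp_mul _ (c1 := fun i => gco i + (-1) * exp_mul (-1) gco i)
        (c2 := delta0)); last first.
      by move=> i; rewrite mulN1r gco_eq.
    rewrite (exp_mul_linear _ _ _ lg (low_order_exp_mul _ lg)) (exp_mul_comp _ _ _ lg) mulN1r.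
    by have -> : - (k + 1)%:~R = - k%:~R - 1 :> CC by rewrite rmorphD opprD.
  have hs : \sum_(m <- irange B) step_diff (k + 1) m * exp_co (- m%:~R) n =
            \sum_(m <- irange B) step_diff k m * exp_co (- m%:~R) n + exp_co (- k%:~R) n.
    have -> : exp_co (- k%:~R) n = \sum_(m <- irange B) (m == k)%:R * exp_co (- m%:~R) n.
      rewrite (bigD1_seq k) ?irange_uniq ?mem_irange //= eqxx mul1r big1 ?addr0 //.
      by move=> m /negPf ->; rewrite mul0r.
    rewrite -big_split; apply: eq_bigr => m _ /=; rewrite -mulrDl; congr (_ * _).
    rewrite /step_diff -addrA; congr (_ + _).
    have [km|km] := eqVneq m k; first by rewrite km lexx (_ : k + 1 <= k = false) ?oppr0 ?addNr
        //; lia.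
    by rewrite addr0 (_ : (k + 1 <= m) = (k <= m)) //; apply/idP/idP; lia.
  rewrite /T hs -hE; ring.
have T0 : T 0 = 0.
  rewrite /T oppr0 exp_mul0 subrr sub0r big1 ?oppr0 // => m _.
  by rewrite /step_diff subrr mul0r.
move=> hM; suff : T M = 0 by move/eqP; rewrite subr_eq0 => /eqP.
case: M hM => k; elim: k => [|k IH] hk //.
- have -> : k.+1%:Z = k%:Z + 1 by lia.
  by rewrite stepT ?IH //; lia.
- by rewrite -stepT.
- rewrite -stepT //; have -> : Negz k.+1 + 1 = Negz k by lia.
  by apply: IH; lia.
Qed.

(** The operator [- M d/dt - d^2/dt^2] has eigenvalue [m (M - m)] on [exp (- m t)], and on
    [exp (- M t) g] it cancels all terms where [g] is not differentiated. *)
Lemma dgco_identity (B : nat) M n : (absz M <= B)%N ->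
  lder (exp_mul (- M%:~R) dgco) n - lder dgco n - M%:~R * dgco n =
  \sum_(m <- irange B) (step_diff M m * (m * (M - m))%:~R) * exp_co (- m%:~R) n.
Proof.
move=> hM; have lg := low_order_gco; have ldg : low_order 2 dgco := low_order_lder lg.
pose s n := gco n - exp_mul (- M%:~R) gco n.
have Ds k : lder s k = dgco k + M%:~R * exp_mul (- M%:~R) gco k - exp_mul (- M%:~R) dgco k.
  by rewrite /lder /s mulrBr -/(lder (exp_mul _ _) k) (exp_mul_der _ _ lg) -/(dgco k); ring.
have DDs k : lder (lder s) k = lder dgco k + M%:~R * lder (exp_mul (- M%:~R) gco) k - lder
    (exp_mul (- M%:~R) dgco) k.
  by rewrite {1}/lder Ds /lder; ring.
have sE k : s k = \sum_(m <- irange B) step_diff M m * exp_co (- m%:~R) k by apply: gco_telescope.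
have DsE k : lder s k = \sum_(m <- irange B) step_diff M m * - m%:~R * exp_co (- m%:~R) k.
  rewrite /lder sE mulr_sumr; apply: eq_bigr => m _.
  by rewrite mulrCA exp_co_der mulrA.
have DDsE k : lder (lder s) k = \sum_(m <- irange B) step_diff M m * (- m%:~R * - m%:~R) *
    exp_co (- m%:~R) k.
  rewrite {1}/lder DsE mulr_sumr; apply: eq_bigr => m _.
  by rewrite mulrCA exp_co_der; ring.
have -> : lder (exp_mul (- M%:~R) dgco) n - lder dgco n - M%:~R * dgco n = - M%:~R * lder s n -
    lder (lder s) n.
  by rewrite DDs Ds (exp_mul_der _ _ lg) -/dgco; ring.
rewrite DDsE DsE mulr_sumr -sumrB; apply: eq_bigr => m _.
by rewrite rmorphM rmorphB /=; ring.
Qed.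

End LaurentSeries.

(** * The central term *)

Section CentralTerm.
Implicit Types (u : lin) (c : int -> CC) (n m M : int).

Lemma csubE l : l 0 0 != 0 -> csub l =1 lsubst l dgco.
Proof.
move=> l0 kap; rewrite /csub (@fsum_single _ _ (deg kap)).
  by rewrite lpowE // eqxx.
by move=> j; apply: contraNeq => jd; rewrite lpowE // [deg _ == _]eq_sym (negPf jd) mulr0.
Qed.

Lemma csub_opp l : l 0 0 != 0 -> csub (- l) =1 lsubst l dgco.
Proof.
move=> l0 kap; rewrite csubE; last by rewrite mxE oppr_eq0.
by rewrite /lsubst lpow_co_opp // mulrA [_ * (-1) ^ _]mulrC dgco_even.
Qed.

Lemma eq_smul4 (f g h : ser4) kap : g =1 h -> smul4 f g kap = smul4 f h kap.
Proof. by move=> gh; apply: eq_fsbigr => iot _; rewrite gh. Qed.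

Lemma expco_conv_box lam (f : ser4) d kap : tame f d ->
  smul4 (expco lam) f kap =
  \sum_(iot <- box (size1 kap + d).+1) expco lam iot * f (kap - iot).
Proof.
move=> tf; apply: fsum_box => iot; apply: contraNeq.
rewrite mulf_eq0 negb_or => /andP[/expco_ge0 i0 fi].
by rewrite -mem_box; apply: tame_box tf i0 fi.
Qed.

Lemma tame_expco lam : tame (expco lam) 0.
Proof. by move=> kap ek; split; [move=> q _; apply: expco_ge0 ek _|apply: expco_deg ek]. Qed.

Lemma tameW (f : ser4) d d' : (d <= d')%N -> tame f d -> tame f d'.
Proof. by move=> dd tf kap /tf [h1 h2]; split => //; lia. Qed.

Lemma tame_linear (a : CC) (f g : ser4) d :
  tame f d -> tame g d -> tame (fun k => f k + a * g k) d.
Proof.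
move=> tf tg kap; have [f0|/tf //] := eqVneq (f kap) 0.
have [g0|/tg //] := eqVneq (g kap) 0.
by rewrite f0 g0 mulr0 addr0 eqxx.
Qed.

Lemma expco_conv_linear lam (a : CC) (f g : ser4) d kap : tame f d -> tame g d ->
  smul4 (expco lam) (fun k => f k + a * g k) kap =
  smul4 (expco lam) f kap + a * smul4 (expco lam) g kap.
Proof.
move=> tf tg; rewrite (expco_conv_box _ _ tf) (expco_conv_box _ _ tg).
rewrite (expco_conv_box _ _ (tame_linear (a := a) tf tg)) mulr_sumr -big_split.
by apply: eq_bigr => iot _; rewrite mulrDr mulrCA.
Qed.

Lemma expco_conv_sum lam (J : Type) (s : seq J) (a : J -> CC) (f : J -> ser4) d kap :
  (forall j, tame (f j) d) ->
  smul4 (expco lam) (fun k => \sum_(j <- s) a j * f j k) kap =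
  \sum_(j <- s) a j * smul4 (expco lam) (f j) kap.
Proof.
move=> tf; have tsum (r : seq J) : tame (fun k => \sum_(j <- r) a j * f j k) d.
  elim: r => [|j r IHr] k; first by rewrite big_nil eqxx.
  by rewrite big_cons addrC; apply: (tame_linear IHr (tf j)).
elim: s => [|j s IHs].
  by rewrite big_nil /smul4 fsbig1 // => iot _; rewrite big_nil mulr0.
rewrite big_cons -IHs addrC -(expco_conv_linear _ _ _ (tsum s) (tf j)).
by apply: eq_smul4 => k; rewrite big_cons addrC.
Qed.

Lemma lsubst_der l c kap q : l 0 0 != 0 ->
  (kap 0 q + 1)%:~R * lsubst l c (kap + delta_mx 0 q) = (l 0 q)%:~R * lsubst l (lder c) kap.
Proof.
by move=> l0; rewrite /lsubst mulrCA lpow_co_der // degD deg_delta /lder; move: (lpow_co l kap)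
    => w; ring.
Qed.

(** The Leibniz rule: [kap 0 q + 1] is shared between the exponents of the two factors, over a
    common box, and each share becomes a derivative. *)
Lemma conv_der lam l c d kap q : l 0 0 != 0 -> low_order d c ->
  (kap 0 q + 1)%:~R * smul4 (expco lam) (lsubst l c) (kap + delta_mx 0 q) =
  (lam 0 q)%:~R * smul4 (expco lam) (lsubst l c) kap +
  (l 0 q)%:~R * smul4 (expco lam) (lsubst l (lder c)) kap.
Proof.
move=> l0 lc; set kap1 : lin := kap + _.
have tc := lsubst_tame (l := l) lc; have tD := lsubst_tame (l := l) (low_order_lder lc).
rewrite (expco_conv_box _ _ tc); set B := box _.
have inB iot (x : CC) : iot \notin B -> x * expco lam iot * lsubst l c (kap1 - iot) = 0.
  apply: contraNeq; rewrite mulf_eq0 negb_or => /andP[xe fi]; move: xe.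
  rewrite mulf_eq0 negb_or => /andP[_ /expco_ge0 i0].
  exact: tame_box tc i0 fi.
transitivity (\sum_(iot <- B) (iot 0 q)%:~R * expco lam iot * lsubst l c (kap1 - iot) +
   \sum_(iot <- B) expco lam iot * ((l 0 q)%:~R * lsubst l (lder c) (kap - iot))).
  rewrite mulr_sumr -big_split; apply: eq_bigr => iot _ /=.
  rewrite -lsubst_der //.
  have -> : kap - iot + delta_mx 0 q = kap1 - iot by rewrite addrAC.
  have -> : (kap - iot) 0 q = kap 0 q - iot 0 q by rewrite !mxE.
  by rewrite [(kap 0 q - _ + 1)%:~R]rmorphD rmorphB rmorphD /=; move: (lsubst _ _ _) => x; ring.
congr (_ + _).
  rewrite -(fsum_seq (box_uniq _)); last by move=> iot; apply: inB.
  rewrite (fsum_shift (delta_mx 0 q)) /smul4 mulr_fsumr; apply: eq_fsbigr => iot _.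
  have -> : kap1 - (iot + delta_mx 0 q) = kap - iot by rewrite /kap1 opprD addrACA subrr addr0.
  have -> : (iot + delta_mx 0 q) 0 q = iot 0 q + 1 by rewrite !mxE !eqxx.
  by rewrite expco_der -[LHS]mulrA.
rewrite -(fsum_seq (box_uniq _)).
  by rewrite /smul4 mulr_fsumr; apply: eq_fsbigr => iot _; rewrite mulrCA.
move=> iot iotB; rewrite -lsubst_der // mulrCA mulrA.
have -> : kap - iot + delta_mx 0 q = kap1 - iot by rewrite addrAC.
exact: inB.
Qed.

Lemma smul41 (f : ser4) : smul4 f one4 =1 f.
Proof.
move=> kap; rewrite /smul4 (@fsum_single _ _ kap) ?subrr /one4 ?eqxx ?mulr1 //.
by move=> iot; apply: contraNeq => ik; rewrite subr_eq0 [kap == iot]eq_sym (negPf ik) mulr0.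
Qed.

Lemma lsubst_delta0 l : lsubst l delta0 =1 one4.
Proof.
move=> kap; rewrite /lsubst /delta0 /one4; have [->|k0] := eqVneq kap 0.
  have d0 : deg 0 = 0 by rewrite /deg big1 // => q _; rewrite mxE.
  have k00 : (0 : lin) 0 0 = 0 by rewrite mxE.
  rewrite /lpow_co d0 k00 subrr /ffact big_ord0.
  by rewrite expr0z !mul1r scale0r subrr expco0.
case: eqVneq => [dk|_]; last by rewrite mul0r.
rewrite mul1r /lpow_co dk sub0r; apply/eqP; rewrite !mulf_eq0; apply/orP.
have [|e0] := eqVneq (expco _ _) 0; [by right|left; apply/orP; left].
have := expco_deg e0; rewrite deg_drop0 dk sub0r => d0.
have := expco_ge0 e0 => kap0.
(* In degree 0 the falling factorial starts with the factor 0 unless it is empty, so only [kap = 0]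
   survives. *)
case E : (absz (- kap 0 0)%R) => [|i]; last by rewrite /ffact big_ord_recl subrr mul0r.
have k00 : kap 0 0 = 0 by lia.
case/eqP: k0; apply/rowP => q; rewrite mxE.
have kge p : 0 <= kap 0 p by have := kap0 p; rewrite k00 scale0r subr0.
by apply/eqP; rewrite eq_le kge -dk deg_ge.
Qed.

Lemma expco_lsubstE (q : int) l kap : l 0 0 != 0 ->
  expco (q *: l) kap = lsubst l (exp_co q%:~R) kap.
Proof.
move=> l0; rewrite -smul41 -(eq_smul4 _ _ (lsubst_delta0 l)) (expco_lsubst _ l0 low_order_delta0).
by rewrite /lsubst exp_mul_delta0.
Qed.

(** Only the coordinates in [y1] and [y2] meet the two derivatives: [d/dy1] acts through [u] alone,
    while [d/dy2] contributes [- M] from [lam] and [- d/du] from [u]. *)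
Lemma central_identity M lam u kap (B : nat) :
  u 0 0 = 1 -> u 0 1 = -1 -> lam 0 0 = 0 -> lam 0 1 = - M -> (absz M <= B)%N ->
  (kap 0 0 + 1)%:~R * smul4 (expco (lam + (- M) *: u)) (csub (- u)) (kap + delta_mx 0 0) +
  (kap 0 1 + 1)%:~R * smul4 (expco lam) (csub u) (kap + delta_mx 0 1) =
  \sum_(m <- irange B) (step_diff M m * (m * (M - m))%:~R) * expco (lam + (- m) *: u) kap.
Proof.
move=> u0 u1 lam0 lam1 hM; have u00 : u 0 0 != 0 by rewrite u0.
have ldg : low_order 2 dgco := low_order_lder low_order_gco.
have lEx : low_order 2 (exp_mul (- M%:~R) dgco) := low_order_exp_mul _ ldg.
rewrite (eq_smul4 _ _ (csub_opp u00)) (eq_smul4 _ _ (csubE u00)).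
rewrite -(expco_conv_assoc _ _ (lsubst_tame (l := u) ldg)) (eq_smul4 _ _ (expco_lsubst (- M)
    u00 ldg)).
rewrite rmorphN /= (conv_der _ _ _ u00 lEx) (conv_der _ _ _ u00 ldg).
rewrite lam0 lam1 u0 u1 mul0r add0r mul1r rmorphN rmorphN1 /=.
transitivity (smul4 (expco lam) (lsubst u (fun n => lder (exp_mul (- M%:~R) dgco) n - lder dgco
    n - M%:~R * dgco n)) kap).
  have tE := lsubst_tame (l := u) (low_order_lder lEx); have tD := lsubst_tame (l := u)
      (low_order_lder ldg).
  have tg := tameW (leqnSn 2) (lsubst_tame (l := u) ldg).
  rewrite [RHS](@eq_smul4 _ _ (fun k => (lsubst u (lder (exp_mul (- M%:~R) dgco)) k + (-1) *
      lsubst u (lder dgco) k) + (- M%:~R) * lsubst u dgco k)).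
    rewrite (expco_conv_linear _ _ _ (tame_linear (a := -1) tE tD) tg) (expco_conv_linear _ _ _
        tE tD).
    by rewrite -addrA; congr (_ + _); rewrite addrC.
  by move=> k; rewrite /lsubst; ring.
rewrite (@eq_smul4 _ _ (fun k => \sum_(m <- irange B) (step_diff M m * (m * (M - m))%:~R) *
    expco ((- m) *: u) k)).
  rewrite (expco_conv_sum _ _ _ _ (fun m => @tame_expco ((- m) *: u))).
  by apply: eq_bigr => m _; rewrite expco_conv.
move=> k; rewrite {1}/lsubst (dgco_identity _ hM) mulr_suml; apply: eq_bigr => m _.
by rewrite expco_lsubstE // /lsubst mulrA rmorphN.
Qed.

End CentralTerm.

(** * Commutators of mode sums *)

Lemma sum_delta (V : lmodType CC) (r : seq int) (a t : int) (b : int -> CC) (X : int -> V) :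
  uniq r -> t \in r ->
  \sum_(i <- r) b i *: ((a *+ (t == i))%:~R *: X i) = (a%:~R * b t) *: X t.
Proof.
move=> ur tr; rewrite (bigD1_seq t) //= eqxx mulr1n big1 ?addr0.
  by rewrite scalerA mulrC.
by move=> i; rewrite eq_sym => /negPf ->; rewrite mulr0n scale0r scaler0.
Qed.

Section BracketOfSums.
Context {V : lmodType CC}.
Variables (h : int -> V -> V) (nn : int -> int -> {linear V -> V}).
Hypothesis nnE : forall m n v,
  nn m n v = h m (h n v) - (m *+ ((0 < m) && (m + n == 0)))%:~R *: v.
Hypothesis nnC : forall m n v, nn m n v = nn n m v.
Hypothesis nn0 : forall N v,
  exists B : nat, forall m : int, (B < absz m)%N -> nn m (N - m) v = 0.
Hypothesis nnB : forall m n r s v,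
  nn m n (nn r s v) - nn r s (nn m n v) =
    (n *+ (n + r == 0))%:~R *: h m (h s v)
  + (n *+ (n + s == 0))%:~R *: h m (h r v)
  + (m *+ (m + r == 0))%:~R *: h s (h n v)
  + (m *+ (m + s == 0))%:~R *: h r (h n v).

Definition modesum (e : int -> CC) (N : int) (v : V) : V :=
  \sum_(m \in @setT int) e m *: nn m (N - m) v.

(** The bound does not depend on [e], so sums with different coefficients share one cutoff. *)
Lemma modesumE N v : exists B0 : nat, forall e B, (B0 <= B)%N ->
  modesum e N v = \sum_(m <- irange B) e m *: nn m (N - m) v.
Proof.
have [B0 hB0] := nn0 N v; exists B0 => e B hB; apply: fsum_int => m hm.
by rewrite hB0 ?scaler0 //; apply: leq_ltn_trans hm.
Qed.

Lemma modesum_is_linear e N : linear (modesum e N).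
Proof.
move=> a u v; have [B1 hB1] := modesumE N u; have [B2 hB2] := modesumE N v.
have [B3 hB3] := modesumE N (a *: u + v); pose B := (B1 + B2 + B3)%N.
rewrite (hB1 _ B) ?(hB2 _ B) ?(hB3 _ B); try by rewrite /B; lia.
rewrite scaler_sumr -big_split; apply: eq_bigr => m _ /=.
by rewrite (linearP (nn m (N - m))) scalerDr !scalerA mulrC.
Qed.
HB.instance Definition _ e N :=
  GRing.isLinear.Build CC V V *:%R (modesum e N) (modesum_is_linear e N).

(** The reflected index matches the products [h (N + m) h (M - m)] that occur in the bracket. *)
Lemma modesum_reflect N M v : exists B0 : nat, forall e B, (B0 <= B)%N ->
  modesum e N v = \sum_(m <- irange B) e (M - m) *: nn (M - m) (N - (M - m)) v.
Proof.
have [B0 hB0] := nn0 N v; exists (B0 + absz M)%N => e B hB.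
rewrite /modesum (fsum_reflect M); apply: fsum_int => m hm.
by rewrite hB0 ?scaler0 //; lia.
Qed.

Variables (eP eQ : int -> CC) (M N : int).

(** Scalars commute with all operators, which removes the singular constants from the left-hand
    side. *)
Lemma modesum_bracket_shift (a b : CC) v :
  2^-1 *: (modesum eP M (2^-1 *: (modesum eQ N v - b *: v)) - a *: (2^-1 *: (modesum eQ N v - b
      *: v)))
  - 2^-1 *: (modesum eQ N (2^-1 *: (modesum eP M v - a *: v)) - b *: (2^-1 *: (modesum eP M v -
      a *: v))) =
  (2^-1 * 2^-1) *: (modesum eP M (modesum eQ N v) - modesum eQ N (modesum eP M v)).
Proof.
have lin e K x y c : modesum e K (2^-1 *: (x - c *: y)) = 2^-1 *: (modesum e K x - c *: modesum
    e K y).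
  by rewrite (linearZ_LR (modesum e K)) (linearB (modesum e K)) (linearZ_LR (modesum e K)).
have swap x c : c *: (2^-1 *: x) = 2^-1 *: (c *: x) :> V by rewrite !scalerA mulrC.
rewrite !lin !swap -!scalerBr !scalerA; congr (_ *: _).
rewrite !scalerBr !scalerA [b * a]mulrC.
have zmod_id (A B C D F : V) : A - B - (C - D) - (F - C - (B - D)) = A - F.
  rewrite -[A - B - _]addrA -opprD -[F - C - _]addrA -[- C - _]opprD [C + (B - D)]addrCA.
  by move: (B + _) => X; rewrite opprB addrA subrK.
exact: zmod_id.
Qed.

(* The range of the second summation is taken so much larger than that of the first *)
(* that every Kronecker delta is hit. *)
Lemma modesum_bracket v : exists B0 : nat, forall B, (B0 <= B)%N ->
  modesum eP M (modesum eQ N v) - modesum eQ N (modesum eP M v) =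
  \sum_(m <- irange B) eP m *:
    (((M - m)%:~R * (eQ (m - M) + eQ (N + M - m))) *: h m (h (N + M - m) v)
     + (m%:~R * (eQ (- m) + eQ (N + m))) *: h (N + m) (h (M - m) v)).
Proof.
have [B1 hB1] := modesumE M (modesum eQ N v); have [B2 hB2] := modesumE N v.
have [B3 hB3] := modesumE M v; have [B4 hB4] := modesumE N (modesum eP M v).
exists (B1 + B2 + B3 + B4)%N => B hB; pose B' := (B + absz M + absz N)%N.
rewrite (hB1 _ B) ?(hB4 _ B'); [|by rewrite /B'; lia|by lia].
rewrite (hB2 _ B') ?(hB3 _ B); [|by lia|by rewrite /B'; lia].
under eq_bigr do rewrite linear_sum scaler_sumr.
under [X in _ - X]eq_bigr do rewrite linear_sum scaler_sumr.
rewrite [X in _ - X]exchange_big /= -sumrB; apply: eq_big_seq => m.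
rewrite mem_irange => hm.
transitivity (eP m *: \sum_(r <- irange B') eQ r *:
   (nn m (M - m) (nn r (N - r) v) - nn r (N - r) (nn m (M - m) v))).
  rewrite -sumrB scaler_sumr; apply: eq_bigr => r _.
  rewrite (linearZ_LR (nn m (M - m))) (linearZ_LR (nn r (N - r))) /= !scalerBr !scalerA.
  by rewrite [eQ r * eP m]mulrC.
congr (_ *: _).
transitivity (\sum_(r <- irange B') (
    eQ r *: (((M - m) *+ (m - M == r))%:~R *: h m (h (N - r) v))
  + eQ r *: (((M - m) *+ (N + M - m == r))%:~R *: h m (h r v))
  + eQ r *: ((m *+ (- m == r))%:~R *: h (N - r) (h (M - m) v))
  + eQ r *: ((m *+ (N + m == r))%:~R *: h r (h (M - m) v)))).
  apply: eq_bigr => r _; rewrite nnB !scalerDr.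
  have -> : (M - m + r == 0) = (m - M == r) by lia.
  have -> : (M - m + (N - r) == 0) = (N + M - m == r) by lia.
  have -> : (m + r == 0) = (- m == r) by lia.
  by have -> : (m + (N - r) == 0) = (N + m == r) by lia.
rewrite !big_split /= !sum_delta ?irange_uniq ?mem_irange //; try by rewrite /B'; lia.
have -> : N - (m - M) = N + M - m by lia.
have -> : N - - m = N + m by lia.
by rewrite -scalerDl -mulrDr -addrA -scalerDl -mulrDr.
Qed.

Lemma modesum_bracket_normal v : exists B0 : nat, forall B, (B0 <= B)%N ->
  modesum eP M (modesum eQ N v) - modesum eQ N (modesum eP M v) =
  \sum_(m <- irange B)
    ((eP m * ((M - m)%:~R * (eQ (m - M) + eQ (N + M - m)))) *: nn m (M + N - m) v
     + (eP m * (m%:~R * (eQ (- m) + eQ (N + m)))) *: nn (M - m) (M + N - (M - m)) v)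
  + (\sum_(m <- irange B) eP m *
      ((M - m)%:~R * (eQ (m - M) + eQ (N + M - m)) * (m *+ ((0 < m) && (M + N == 0)))%:~R
     + m%:~R * (eQ (- m) + eQ (N + m)) * ((N + m) *+ ((0 < N + m) && (M + N == 0)))%:~R)) *: v.
Proof.
have [B0 hB0] := modesum_bracket v; exists B0 => B /hB0 ->.
rewrite scaler_suml -big_split; apply: eq_bigr => m _ /=.
have hh a b : h a (h b v) = nn a b v + (a *+ ((0 < a) && (a + b == 0)))%:~R *: v.
  by rewrite nnE subrK.
(* Swapping the factors turns the second product into the mode [M - m] of degree [M + N], the form
   given by reflection. *)
rewrite !hh (nnC (N + m)).
have -> : M + N - m = N + M - m by lia.
have -> : M + N - (M - m) = N + m by lia.
have -> : (m + (N + M - m) == 0) = (M + N == 0) by lia.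
have -> : (N + m + (M - m) == 0) = (M + N == 0) by lia.
rewrite !scalerDr !scalerA addrACA -scalerDl; congr (_ + _ *: v).
by ring.
Qed.

End BracketOfSums.

Section ModuleConvolution.
Context {V : lmodType CC}.

Lemma conv_mod (lam kap : lin) (r : seq int) (mu : int -> lin) (w : int -> V)
    (f : ser4) (d : nat) (v : V) : tame f d ->
  \sum_(iot \in @setT lin) expco lam iot *:
     (2^-1 *: (\sum_(m <- r) expco (mu m) (kap - iot) *: w m - f (kap - iot) *: v)) =
  2^-1 *: (\sum_(m <- r) expco (lam + mu m) kap *: w m - smul4 (expco lam) f kap *: v).
Proof.
move=> tf; pose b := box (size1 kap + d).+1.
have tmu m : tame (expco (mu m)) d := tameW (leq0n d) (@tame_expco (mu m)).
rewrite (@fsum_seq _ _ b) ?box_uniq //; last first.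
  move=> iot iotb; have [->|e0] := eqVneq (expco lam iot) 0; first by rewrite scale0r.
  have i0 := expco_ge0 e0.
  have f0 (g : ser4) : tame g d -> g (kap - iot) = 0.
    by move=> tg; apply/eqP; apply: contraNT iotb => /(tame_box tg i0).
  by rewrite f0 // scale0r subr0 big1 ?scaler0 // => m _; rewrite (f0 _ (tmu m)) scale0r.
under eq_bigr do rewrite scalerA mulrC -scalerA.
rewrite -scaler_sumr; congr (_ *: _).
under eq_bigr do rewrite scalerBr scaler_sumr scalerA.
rewrite sumrB exchange_big /= (expco_conv_box _ _ tf) scaler_suml; congr (_ - _).
apply: eq_bigr => m _; rewrite -expco_conv (expco_conv_box _ _ (tmu m)) scaler_suml.
by apply: eq_bigr => iot _; rewrite scalerA.
Qed.

End ModuleConvolution.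

(** [Y] will be the reflected modes from the [y1] derivative and [X] the direct modes from the [y2]
    derivative. *)
Lemma quarter_combine (V : lmodType CC) (r : seq int) (X Y : int -> V) (v : V)
    (a1 a2 a3 a4 : int -> CC) (k1 k2 c1 c2 c3 c4 : CC) :
  - 2^-1 *: (k1 *: (2^-1 *: (\sum_(m <- r) a1 m *: Y m - c1 *: v) +
                    2^-1 *: (\sum_(m <- r) a2 m *: Y m - c2 *: v))) +
  - 2^-1 *: (k2 *: (2^-1 *: (\sum_(m <- r) a3 m *: X m - c3 *: v) +
                    2^-1 *: (\sum_(m <- r) a4 m *: X m - c4 *: v))) =
  (2^-1 * 2^-1) *: (\sum_(m <- r) ((- (k2 * (a3 m + a4 m))) *: X m +
                                  (- (k1 * (a1 m + a2 m))) *: Y m) +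
                   (k1 * (c1 + c2) + k2 * (c3 + c4)) *: v).
Proof.
have half k b1 b2 d1 d2 (Z : int -> V) :
    - 2^-1 *: (k *: (2^-1 *: (\sum_(m <- r) b1 m *: Z m - d1 *: v) +
                    2^-1 *: (\sum_(m <- r) b2 m *: Z m - d2 *: v))) =
    (2^-1 * 2^-1) *: (\sum_(m <- r) (- (k * (b1 m + b2 m))) *: Z m + (k * (d1 + d2)) *: v).
  have scal (x : V) : - 2^-1 *: (k *: (2^-1 *: x)) = (2^-1 * 2^-1) *: (- k *: x).
    by rewrite !scalerA; congr (_ *: _); ring.
  rewrite -[2^-1 *: _ + 2^-1 *: _]scalerDr scal; congr (_ *: _).
  rewrite addrACA -opprD -scalerDl scalerBr scalerA -big_split /=.
  rewrite -[- (_ *: v)]scaleNr -[- (- k * _)]mulNr opprK scaler_sumr; congr (_ + _); apply: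
      eq_bigr => m _.
  by rewrite -scalerDl scalerA mulNr.
rewrite !half -scalerDr; congr (_ *: _).
by rewrite addrACA -scalerDl -big_split /=; congr (_ + _); apply: eq_bigr => m _; rewrite addrC.
Qed.

(** * Coefficients of the operator series *)

Implicit Types (k i : E).

Lemma yvE (q : nat) (p : 'I_4) : (0 < q <= 4)%N -> yv q 0 p = (p.+1 == q)%:R.
Proof.
case: q => // q hq; rewrite mxE eqxx /= eqSS -val_eqE /= inordK //.
Qed.

Lemma lt_Yv (q : 'I_4) : (q.+2 < 6)%N.
Proof. exact: ltn_ord q. Qed.

Lemma ordE_cases (j : 'I_6) : [\/ j = X1, j = X2 | exists q : 'I_4, j = inord q.+2].
Proof.
case: j => -[|[|j]] hj.
- by apply: Or31; apply/val_inj; rewrite /= inordK.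
- by apply: Or32; apply/val_inj; rewrite /= inordK.
- by apply: Or33; exists (Ordinal (hj : (j < 4)%N)); apply/val_inj; rewrite /= inordK.
Qed.

Lemma E_ext k i : k 0 X1 = i 0 X1 -> k 0 X2 = i 0 X2 -> ypart k = ypart i -> k = i.
Proof.
move=> h1 h2 /rowP hy; apply/rowP => j.
have [->|->|[q ->]] := ordE_cases j => //.
by have := hy q; rewrite !mxE.
Qed.

Definition emb (a b : int) (iot : lin) : E :=
  \row_(j < 6) if j == X1 then a else if j == X2 then b else iot 0 (inord (j - 2)).

Lemma embX1 a b iot : emb a b iot 0 X1 = a.
Proof. by rewrite mxE eqxx. Qed.

Lemma embX2 a b iot : emb a b iot 0 X2 = b.
Proof. by rewrite mxE eqxx -val_eqE /= !inordK. Qed.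

Lemma ypart_emb a b iot : ypart (emb a b iot) = iot.
Proof.
apply/rowP => q; rewrite !mxE -!val_eqE /= !inordK ?lt_Yv //=.
by rewrite ?subSS ?subn0 /= inord_val.
Qed.

Lemma ypartD k i : ypart (k + i) = ypart k + ypart i.
Proof. by apply/rowP => q; rewrite !mxE. Qed.

Lemma ypartB k i : ypart (k - i) = ypart k - ypart i.
Proof. by apply/rowP => q; rewrite !mxE. Qed.

Lemma ypart_delta (q : 'I_4) : ypart (delta_mx 0 (Yv q.+1)) = delta_mx 0 q.
Proof.
by apply/rowP => p; rewrite !mxE eqxx /= -!val_eqE /= !inordK ?lt_Yv.
Qed.

Lemma delta_YvX1 (q : 'I_4) : (delta_mx 0 (Yv q.+1) : E) 0 X1 = 0.
Proof. by rewrite mxE eqxx -val_eqE /= !inordK ?lt_Yv. Qed.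

Lemma delta_YvX2 (q : 'I_4) : (delta_mx 0 (Yv q.+1) : E) 0 X2 = 0.
Proof. by rewrite mxE eqxx -val_eqE /= !inordK ?lt_Yv. Qed.

Lemma YvE k (q : 'I_4) : k 0 (Yv q.+1) = ypart k 0 q.
Proof. by rewrite mxE. Qed.

Local Notation msum := (modesum (fun m n => nop m n : {linear S -> S})).

Definition NOco (a b : lin) (N : int) (kap : lin) (m : int) : CC :=
  expco (- (m *: a) - (N - m) *: b) kap.

Lemma NO_X1 a b v k : NO a b X1 v k =
  if k 0 X2 == 0 then msum (NOco a b (- k 0 X1) (ypart k)) (- k 0 X1) v else 0.
Proof.
rewrite /NO (_ : [forall j, _] = (k 0 X2 == 0)) //.
apply/forallP/idP => [/(_ X2)|k0 j].
  by rewrite -val_eqE /= !inordK.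
have [->|->|[q ->]] := ordE_cases j; rewrite ?eqxx ?andbF ?k0 ?implybT //.
by rewrite inordK ?lt_Yv.
Qed.

Lemma NO_X2 a b v k : NO a b X2 v k =
  if k 0 X1 == 0 then msum (NOco a b (- k 0 X2) (ypart k)) (- k 0 X2) v else 0.
Proof.
rewrite /NO (_ : [forall j, _] = (k 0 X1 == 0)) //.
apply/forallP/idP => [/(_ X1)|k0 j].
  by rewrite -val_eqE /= !inordK.
have [->|->|[q ->]] := ordE_cases j; rewrite ?eqxx ?andbF ?k0 ?implybT //.
by rewrite inordK ?lt_Yv.
Qed.

Lemma fsum_neq0 (V : zmodType) (T : choiceType) (F : T -> V) :
  \sum_(x \in @setT T) F x != 0 -> exists x, F x != 0.
Proof.
apply: contra_neqP => /forallNP h; apply: fsbig1 => x _; apply/eqP.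
by have := h x; move/negP; rewrite negbK.
Qed.

(** Stated for any leading variable because [y3 - y4], on the left, does not contain [y1]. *)
Lemma csub_eq0 l q kap : l 0 (fstv l) != 0 -> l 0 q = 0 -> csub l kap != 0 -> kap 0 q = 0.
Proof.
move=> lp lq; have pq : q != fstv l by apply: contraNneq lp => <-; rewrite lq.
have spow0 n kap' : spow4 (rest l) n kap' != 0 -> kap' 0 q = 0.
  elim: n kap' => [|n IHn] kap'.
    rewrite /spow4 /= /one4; have [->|_] := eqVneq kap' 0; first by rewrite mxE.
    by rewrite eqxx.
  rewrite /spow4 iterS -/(spow4 _ _) => /fsum_neq0 [iot].
  rewrite mulf_eq0 negb_or => /andP[ri /IHn]; rewrite !mxE => /eqP; rewrite subr_eq0 => /eqP ->.
  have [p _ /eqP] : exists2 p, p != fstv l & (l 0 p)%:~R * (iot == delta_mx 0 p)%:R != 0 :> CC.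
    move: ri; rewrite /rest; apply: contra_neqP => /forall2NP h.
    by rewrite big1 // => p pf; case: (h p) => // /negP; rewrite negbK => /eqP.
  have [->|_] := eqVneq iot (delta_mx 0 p); last by rewrite mulr0.
  by rewrite mxE eqxx /=; case: eqVneq => // <-; rewrite lq mul0r.
move=> /fsum_neq0 [j]; rewrite mulf_eq0 negb_or => /andP[_ /fsum_neq0 [n]].
rewrite mulf_eq0 negb_or => /andP[_ /spow0].
by rewrite !mxE eqxx (negPf pq) /= mulr0 subr0.
Qed.

Implicit Types (a b : lin).

Lemma tame_csub l : l 0 0 != 0 -> tame (csub l) 2.
Proof.
move=> l0 kap; rewrite csubE //.
exact: (lsubst_tame (l := l) (low_order_lder low_order_gco : low_order 2 dgco)).
Qed.

Lemma Lbar_X1 a b w i : i 0 X2 = 0 -> Lbar a b X1 w i =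
  2^-1 *: (msum (NOco a b (- i 0 X1) (ypart i)) (- i 0 X1) w -
           (if i 0 X1 == 0 then csub (a - b) (ypart i) else 0) *: w).
Proof.
move=> i2; rewrite /Lbar NO_X1 i2 eqxx andbT.
by case: (i 0 X1 == 0); rewrite ?scale0r.
Qed.

Lemma Lbar_X2 a b w i : i 0 X1 = 0 -> Lbar a b X2 w i =
  2^-1 *: (msum (NOco a b (- i 0 X2) (ypart i)) (- i 0 X2) w -
           (if i 0 X2 == 0 then csub (a - b) (ypart i) else 0) *: w).
Proof.
move=> i1; rewrite /Lbar NO_X2 i1 eqxx /=.
by case: (i 0 X2 == 0); rewrite ?scale0r.
Qed.

Lemma Lbar_X1_emb a b w x iot : Lbar a b X1 w (emb x 0 iot) =
  2^-1 *: (msum (NOco a b (- x) iot) (- x) w -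
           (if x == 0 then csub (a - b) iot else 0) *: w).
Proof.
have gen i : i 0 X1 = x -> i 0 X2 = 0 -> ypart i = iot -> Lbar a b X1 w i =
    2^-1 *: (msum (NOco a b (- x) iot) (- x) w - (if x == 0 then csub (a - b) iot else 0) *: w).
  by move=> <- i2 <-; exact: Lbar_X1.
by apply: gen; [exact: embX1 | exact: embX2 | exact: ypart_emb].
Qed.

Lemma Lbar_X2_emb a b w x iot : Lbar a b X2 w (emb 0 x iot) =
  2^-1 *: (msum (NOco a b (- x) iot) (- x) w -
           (if x == 0 then csub (a - b) iot else 0) *: w).
Proof.
have gen i : i 0 X2 = x -> i 0 X1 = 0 -> ypart i = iot -> Lbar a b X2 w i =
    2^-1 *: (msum (NOco a b (- x) iot) (- x) w - (if x == 0 then csub (a - b) iot else 0) *: w).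
  by move=> <- i1 <-; exact: Lbar_X2.
by apply: gen; [exact: embX2 | exact: embX1 | exact: ypart_emb].
Qed.

Lemma Lbar_X1_supp a b w i : Lbar a b X1 w i != 0 -> i 0 X2 = 0.
Proof.
have [//|/negPf i2] := eqVneq (i 0 X2) 0.
by rewrite /Lbar NO_X1 i2 andbF subr0 scaler0 eqxx.
Qed.

Lemma Lbar_X2_supp a b w i : Lbar a b X2 w i != 0 -> i 0 X1 = 0.
Proof.
have [//|/negPf i1] := eqVneq (i 0 X1) 0.
by rewrite /Lbar NO_X2 i1 /= subr0 scaler0 eqxx.
Qed.

Lemma Lbar_y_supp a b xi w i q : a 0 q = 0 -> b 0 q = 0 ->
  (a - b) 0 (fstv (a - b)) != 0 -> Lbar a b xi w i != 0 -> ypart i 0 q = 0.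
Proof.
move=> aq bq ab; have [//|yq] := eqVneq (ypart i 0 q) 0.
have csub0 : csub (a - b) (ypart i) = 0.
  apply/eqP; apply: contraNT yq => /(csub_eq0 ab) -> //.
  by rewrite !mxE aq bq subr0.
have expco0 m n : expco (- (m *: a) - n *: b) (ypart i) = 0.
  apply/eqP; apply: contraNT yq => /(@expco_eq0 _ _ q) -> //.
  by rewrite !mxE aq bq !mulr0 subr0.
have NO0 : NO a b xi w i = 0.
  by rewrite /NO; case: ifP => // _; apply: fsbig1 => m _; rewrite expco0 scale0r.
by rewrite /Lbar NO0 csub0 scale0r if_same subr0 scaler0 eqxx.
Qed.

Lemma Lbar0 a b xi i : Lbar a b xi 0 i = 0.
Proof.
have NO0 : NO a b xi 0 i = 0.
  by rewrite /NO; case: ifP => // _; apply: fsbig1 => m _; rewrite linear0 scaler0.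
by rewrite /Lbar NO0 scaler0 if_same subr0 scaler0.
Qed.

(** In a composite, a nonzero value thereby yields the support conditions of the inner factor
    too. *)
Lemma Lbar_arg_neq0 a b xi w i : Lbar a b xi w i != 0 -> w != 0.
Proof. by apply: contra_neq => ->; apply: Lbar0. Qed.

Lemma scale_neq0 (F : fieldType) (V : lmodType F) (c : F) (x : V) :
  c *: x != 0 -> c != 0 /\ x != 0.
Proof. by rewrite scaler_eq0 negb_or => /andP[]. Qed.

Lemma fstv_neq0 l p : l 0 p != 0 -> (forall q : 'I_4, (q < p)%N -> l 0 q = 0) ->
  l 0 (fstv l) != 0.
Proof.
move=> lp lq; rewrite /fstv; case: pickP => [r /andP[] //|/(_ p)].
rewrite lp /= => /negbT /forallPn [q]; rewrite negb_imply => /andP[qp].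
by rewrite lq.
Qed.

Lemma scmulE a1 b1 a b v k : (a - b) 0 0 != 0 ->
  scmul (Delta a1 b1) (Lbar a b X2) v k =
  2^-1 *: (msum (fun m => expco (k 0 X1 *: (a1 - b1) +
                    (- (m *: a) - (- (k 0 X1 + k 0 X2) - m) *: b)) (ypart k))
                (- (k 0 X1 + k 0 X2)) v -
           (if k 0 X1 + k 0 X2 == 0
            then smul4 (expco (k 0 X1 *: (a1 - b1))) (csub (a - b)) (ypart k) else 0) *: v).
Proof.
move=> ab0; set K := - (k 0 X1 + k 0 X2); set lam := k 0 X1 *: (a1 - b1).
(* The central part becomes one series, zero outside total degree 0, so that [conv_mod] covers both
   cases. *)
pose f : ser4 := if k 0 X1 + k 0 X2 == 0 then csub (a - b) else fun=> 0.
have tf : tame f 2.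
  by rewrite /f; case: ifP => _; [exact: tame_csub | move=> kap; rewrite eqxx].
(* [Lbar] contains no [x1], so the delta function must supply the whole power of [x1] and the
   opposite power of [x2]; only the [y] exponents remain free. *)
rewrite /scmul (@fsum_inj _ _ _ (emb (k 0 X1) (- k 0 X1))); last first.
- move=> i /scale_neq0 [D0 /Lbar_X2_supp L0].
  have i1 : i 0 X1 = k 0 X1 by move: L0; rewrite !mxE => /eqP; rewrite subr_eq0 => /eqP.
  exists (ypart i); apply: E_ext; rewrite ?embX1 ?embX2 ?ypart_emb //.
  by move: D0; rewrite /Delta; case: ifP => [/eqP ->|_]; rewrite ?i1 // eqxx.
- by move=> i1 i2 /(congr1 ypart); rewrite !ypart_emb.
have [B hB] := modesumE nop_eventually0 K v.
have term iot : Delta a1 b1 (emb (k 0 X1) (- k 0 X1) iot) *: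
    Lbar a b X2 v (k - emb (k 0 X1) (- k 0 X1) iot) = expco lam iot *:
  (2^-1 *: (\sum_(m <- irange B) expco (- (m *: a) - (K - m) *: b) (ypart k - iot) *: nop m (K
      - m) v
            - f (ypart k - iot) *: v)).
  rewrite [Delta _ _ _](_ : _ = expco lam iot); last first.
    by rewrite /Delta embX1 embX2 eqxx ypart_emb.
  rewrite Lbar_X2; last by rewrite !mxE eqxx subrr.
  have -> : (k - emb (k 0 X1) (- k 0 X1) iot) 0 X2 = k 0 X1 + k 0 X2.
    by rewrite mxE [X in _ + X]mxE embX2 opprK addrC.
  rewrite ypartB ypart_emb (hB _ B (leqnn B)).
  have -> : (if k 0 X1 + k 0 X2 == 0 then csub (a - b) (ypart k - iot) else 0) =
            f (ypart k - iot) by rewrite /f; case: (_ == 0).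
  by [].
under eq_fsbigr do rewrite term.
rewrite (hB _ B (leqnn B)) (conv_mod _ _ _ _ _ _ tf).
have -> : smul4 (expco lam) f (ypart k) =
    if k 0 X1 + k 0 X2 == 0 then smul4 (expco lam) (csub (a - b)) (ypart k) else 0.
  rewrite /f; case: (_ == 0) => //; rewrite /smul4 fsbig1 // => iot _; exact: mulr0.
by [].
Qed.

Definition ypart12 kap : lin := \row_q if (q < 2)%N then kap 0 q else 0.
Definition ypart34 kap : lin := \row_q if (q < 2)%N then 0 else kap 0 q.

Lemma expco_split lam mu kap :
  (forall q : 'I_4, (2 <= q)%N -> lam 0 q = 0) ->
  (forall q : 'I_4, (q < 2)%N -> mu 0 q = 0) ->
  expco lam (ypart12 kap) * expco mu (ypart34 kap) = expco (lam + mu) kap.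
Proof.
move=> l0 m0; rewrite [in LHS]expcoE [expco mu _]expcoE [RHS]expcoE -big_split.
apply: eq_bigr => q _ /=; rewrite !mxE; case: ltnP => hq.
  by rewrite m0 // addr0 exp_co0 eqxx mulr1.
by rewrite l0 // add0r exp_co0 eqxx mul1r.
Qed.

(** The factors involve the disjoint variables [x1, y1, y2] and [x2, y3, y4], so only one splitting
    of the exponent [k] contributes to each product. *)
Lemma opbrE v k (M := - k 0 X1) (N := - k 0 X2) (kap := ypart k)
    (eP := NOco (yv 1) (yv 2) M (ypart12 kap)) (eQ := NOco (yv 3) (yv 4) N (ypart34 kap)) :
  opbr (Lbar (yv 1) (yv 2) X1) (Lbar (yv 3) (yv 4) X2) v k =
  (2^-1 * 2^-1) *: (msum eP M (msum eQ N v) - msum eQ N (msum eP M v)).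
Proof.
have f12 : (yv 1 - yv 2) 0 (fstv (yv 1 - yv 2)) != 0.
  by apply: (@fstv_neq0 _ 0) => [|q]; [rewrite mxE [X in _ + X]mxE !yvE | rewrite ltn0].
have f34 : (yv 3 - yv 4) 0 (fstv (yv 3 - yv 4)) != 0.
  apply: (@fstv_neq0 _ (Ordinal (isT : (2 < 4)%N))) => [|q /= q2]; rewrite mxE [X in _ + X]mxE
      !yvE //.
  by case: q q2 => -[|[|q]].
have A_supp w i (q : 'I_4) : Lbar (yv 1) (yv 2) X1 w i != 0 -> (2 <= q)%N -> ypart i 0 q = 0.
  move=> Ai q2; apply: Lbar_y_supp Ai => //; rewrite yvE //; case: q q2 => -[|[|q]] //.
have B_supp w i (q : 'I_4) : Lbar (yv 3) (yv 4) X2 w i != 0 -> (q < 2)%N -> ypart i 0 q = 0.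
  move=> Bi q2; apply: Lbar_y_supp Bi => //; rewrite yvE //; case: q q2 => -[|[|q]] //.
pose i0 := emb (k 0 X1) 0 (ypart12 kap); pose j0 := emb 0 (k 0 X2) (ypart34 kap).
have ki0 : k - i0 = j0.
  apply: E_ext; rewrite ?ypartB ?ypart_emb ?embX1 ?embX2.
  - by rewrite mxE [X in _ + X]mxE embX1 subrr.
  - by rewrite mxE [X in _ + X]mxE embX2 subr0.
  - by apply/rowP => q; rewrite !mxE; case: ifP; rewrite ?subrr ?subr0.
have kj0 : k - j0 = i0 by rewrite -ki0 subKr.
have AB i w : Lbar (yv 1) (yv 2) X1 (Lbar (yv 3) (yv 4) X2 w (k - i)) i != 0 -> i = i0.
  move=> Ai; have i2 := Lbar_X1_supp Ai; have iy q := A_supp _ _ q Ai.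
  have Bi := Lbar_arg_neq0 Ai.
  have := Lbar_X2_supp Bi; rewrite mxE [X in _ + X]mxE => /eqP; rewrite subr_eq0 => /eqP i1.
  have jy q := B_supp _ _ q Bi.
  apply: E_ext; rewrite ?embX1 ?embX2 ?ypart_emb //.
  apply/rowP => q; rewrite [RHS]mxE; case: ltnP => hq; last exact: iy.
  by have := jy q hq; rewrite ypartB mxE [X in _ + X]mxE => /eqP; rewrite subr_eq0 => /eqP.
have BA i w : Lbar (yv 3) (yv 4) X2 (Lbar (yv 1) (yv 2) X1 w (k - i)) i != 0 -> i = j0.
  move=> Bi; have i1 := Lbar_X2_supp Bi; have iy q := B_supp _ _ q Bi.
  have Ai := Lbar_arg_neq0 Bi.
  have := Lbar_X1_supp Ai; rewrite mxE [X in _ + X]mxE => /eqP; rewrite subr_eq0 => /eqP i2.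
  have jy q := A_supp _ _ q Ai.
  apply: E_ext; rewrite ?embX1 ?embX2 ?ypart_emb //.
  apply/rowP => q; rewrite [RHS]mxE; case: ltnP => hq; first exact: iy.
  by have := jy q hq; rewrite ypartB mxE [X in _ + X]mxE => /eqP; rewrite subr_eq0 => /eqP.
have e1 : opmul (Lbar (yv 1) (yv 2) X1) (Lbar (yv 3) (yv 4) X2) v k =
    Lbar (yv 1) (yv 2) X1 (Lbar (yv 3) (yv 4) X2 v (k - i0)) i0.
  by apply: fsum_single => i; exact: AB.
have e2 : opmul (Lbar (yv 3) (yv 4) X2) (Lbar (yv 1) (yv 2) X1) v k =
    Lbar (yv 3) (yv 4) X2 (Lbar (yv 1) (yv 2) X1 v (k - j0)) j0.
  by apply: fsum_single => i; exact: BA.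
pose cA := if k 0 X1 == 0 then csub (yv 1 - yv 2) (ypart12 kap) else 0.
pose cB := if k 0 X2 == 0 then csub (yv 3 - yv 4) (ypart34 kap) else 0.
have eA w : Lbar (yv 1) (yv 2) X1 w i0 = 2^-1 *: (msum eP M w - cA *: w).
  exact: Lbar_X1_emb.
have eB w : Lbar (yv 3) (yv 4) X2 w j0 = 2^-1 *: (msum eQ N w - cB *: w).
  exact: Lbar_X2_emb.
rewrite ki0 in e1; rewrite kj0 in e2.
have {}e1 := etrans e1 (etrans (eA _) (congr1 (fun w => 2^-1 *: (msum eP M w - cA *: w)) (eB v))).
have {}e2 := etrans e2 (etrans (eB _) (congr1 (fun w => 2^-1 *: (msum eQ N w - cB *: w)) (eA v))).
apply: etrans (congr2 (fun x y : S => x - y) e1 e2) _.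
exact: (modesum_bracket_shift nop_eventually0).
Qed.

Lemma scmul_shift (q : 'I_4) a1 b1 a b v k (M := - k 0 X1) (N := - k 0 X2)
    (kap := ypart k + delta_mx 0 q) : (a - b) 0 0 != 0 ->
  scmul (Delta a1 b1) (Lbar a b X2) v (k + delta_mx 0 (Yv q.+1)) =
  2^-1 *: (msum (fun m => expco ((- M) *: (a1 - b1) +
                    (- (m *: a) - (M + N - m) *: b)) kap) (M + N) v -
           (if M + N == 0
            then smul4 (expco ((- M) *: (a1 - b1))) (csub (a - b)) kap else 0) *: v).
Proof.
move=> ab0.
have gen k' : - k' 0 X1 = M -> - k' 0 X2 = N -> ypart k' = kap ->
    scmul (Delta a1 b1) (Lbar a b X2) v k' =
  2^-1 *: (msum (fun m => expco ((- M) *: (a1 - b1) +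
                    (- (m *: a) - (M + N - m) *: b)) kap) (M + N) v -
           (if M + N == 0
            then smul4 (expco ((- M) *: (a1 - b1))) (csub (a - b)) kap else 0) *: v).
  move=> <- <- <-; rewrite -opprD oppr_eq0 opprK.
  exact: scmulE.
apply: gen.
- by rewrite mxE delta_YvX1 addr0.
- by rewrite mxE delta_YvX2 addr0.
- by rewrite ypartD ypart_delta.
Qed.

(** * Matching the quadratic and central coefficients *)

Section Scalars.
Variables (y1 y2 c d : lin) (M N : int) (kap : lin).
Hypotheses (y10 : y1 0 0 = 1) (y11 : y1 0 1 = 0) (y20 : y2 0 0 = 0) (y21 : y2 0 1 = 1).
Hypotheses (c0 : c 0 0 = 0) (c1 : c 0 1 = 0) (d0 : d 0 0 = 0) (d1 : d 0 1 = 0).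

(** The shift by [- M] from the delta function makes mode [M - m] on the right carry the exponential
    of mode [m] on the left, hence the reflected index. *)
Lemma quadratic_term1 (m : int) :
  (kap 0 0 + 1)%:~R * expco ((- M) *: (y1 - c) +
    (- ((M - m) *: (- y1 + y2 + c)) - (M + N - (M - m)) *: d)) (kap + delta_mx 0 0) =
  - (m%:~R * expco (- (m *: y1) - (M - m) *: y2 + (m *: c - (N + m) *: d)) kap).
Proof.
rewrite [X in expco X _](_ : _ = - (m *: y1) - (M - m) *: y2 + (m *: c - (N + m) *: d)).
  by rewrite expco_der !mxE y10 y20 c0 d0 -mulNr -rmorphN; congr (_%:~R * _); ring.
by apply/rowP => q; rewrite !mxE; move: (y1 0 q) (y2 0 q) (c 0 q) (d 0 q) => *; ring.
Qed.

Lemma quadratic_term2 (m : int) :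
  (kap 0 1 + 1)%:~R * expco ((- M) *: (y2 - c) +
    (- (m *: (y1 - y2 + c)) - (M + N - m) *: d)) (kap + delta_mx 0 1) =
  - ((M - m)%:~R *
     expco (- (m *: y1) - (M - m) *: y2 + ((M - m) *: c - (N + M - m) *: d)) kap).
Proof.
rewrite [X in expco X _](_ : _ = - (m *: y1) - (M - m) *: y2 + ((M - m) *: c - (N + M - m) *: d)).
  by rewrite expco_der !mxE y11 y21 c1 d1 -mulNr -rmorphN; congr (_%:~R * _); ring.
by apply/rowP => q; rewrite !mxE; move: (y1 0 q) (y2 0 q) (c 0 q) (d 0 q) => *; ring.
Qed.

(** Used twice, with [c, d] equal to [y3, y4] and then to [y4, y3]. *)
Lemma central_term (B : nat) : (absz M <= B)%N ->
  (kap 0 0 + 1)%:~R * smul4 (expco ((- M) *: (y1 - c))) (csub (- y1 + y2 + c - d)) (kap +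
      delta_mx 0 0) +
  (kap 0 1 + 1)%:~R * smul4 (expco ((- M) *: (y2 - d))) (csub (y1 - y2 + d - c)) (kap +
      delta_mx 0 1) =
  \sum_(m <- irange B) (step_diff M m * (m * (M - m))%:~R) *
    expco (- (m *: y1) - (M - m) *: y2 + (m *: c + (M - m) *: d)) kap.
Proof.
move=> hM; pose u := y1 - y2 + d - c; pose lam := (- M) *: (y2 - d).
have -> : (- M) *: (y1 - c) = lam + (- M) *: u.
  by apply/rowP => q; rewrite !mxE; move: (y1 0 q) (y2 0 q) (c 0 q) (d 0 q) => *; ring.
have -> : - y1 + y2 + c - d = - u.
  by apply/rowP => q; rewrite !mxE; move: (y1 0 q) (y2 0 q) (c 0 q) (d 0 q) => *; ring.
rewrite (@central_identity M lam u kap B) //; try by rewrite !mxE ?y10 ?y11 ?y20 ?y21 ?c0 ?c1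
    ?d0 ?d1; ring.
apply: eq_bigr => m _; congr (_ * expco _ _).
by apply/rowP => q; rewrite !mxE; move: (y1 0 q) (y2 0 q) (c 0 q) (d 0 q) => *; ring.
Qed.

End Scalars.

Lemma sum_ext (V : lmodType CC) (r : seq int) (X Y : int -> V) (v : V)
    (a b a' b' : int -> CC) (c c' : CC) : a =1 a' -> b =1 b' -> c = c' ->
  \sum_(m <- r) (a m *: X m + b m *: Y m) + c *: v =
  \sum_(m <- r) (a' m *: X m + b' m *: Y m) + c' *: v.
Proof.
by move=> aE bE ->; congr (_ + _); apply: eq_bigr => m _; rewrite aE bE.
Qed.

(** Normal ordering produces strict inequalities and telescoping produces weak ones; the boundary
    values [m = 0] and [m = M] are killed by [m (M - m)]. *)
Lemma step_diff_strict (M m : int) :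
  step_diff M m * (m * (M - m))%:~R =
  (M - m)%:~R * (m *+ (0 < m)%R)%:~R + m%:~R * ((m - M) *+ (0 < m - M)%R)%:~R.
Proof.
rewrite /step_diff subr_gt0 !le_eqVlt.
have [<-|m0] := eqVneq 0 m; first by rewrite !(mul0r, mulr0, mul0rn) addr0.
have [->|mM] := eqVneq M m; first by rewrite subrr !(mul0r, mulr0, mul0rn) addr0.
rewrite /=; case: (0 < m); case: (M < m); rewrite ?mulr1n ?mulr0n !rmorphM !rmorphB /=; ring.
Qed.

Section Coefficients.
Variables (y1 y2 y3 y4 : lin) (M N : int) (kap : lin) (eP eQ : int -> CC).
Hypotheses (y10 : y1 0 0 = 1) (y11 : y1 0 1 = 0) (y20 : y2 0 0 = 0) (y21 : y2 0 1 = 1).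
Hypotheses (y30 : y3 0 0 = 0) (y31 : y3 0 1 = 0) (y40 : y4 0 0 = 0) (y41 : y4 0 1 = 0).
Hypothesis ePQ : forall m r, eP m * eQ r =
  expco (- (m *: y1) - (M - m) *: y2 + (- (r *: y3) - (N - r) *: y4)) kap.

Lemma quadratic_coef1 (m : int) :
  eP m * (m%:~R * (eQ (- m) + eQ (N + m))) =
  - ((kap 0 0 + 1)%:~R *
     (expco ((- M) *: (y1 - y3) + (- ((M - m) *: (- y1 + y2 + y3)) - (M + N - (M - m)) *: y4))
        (kap + delta_mx 0 0) +
      expco ((- M) *: (y1 - y4) + (- ((M - m) *: (- y1 + y2 + y4)) - (M + N - (M - m)) *: y3))
        (kap + delta_mx 0 0))).
Proof.
rewrite [in RHS]mulrDr !quadratic_term1 // opprD !opprK [LHS]mulrCA [eP m * _]mulrDr !ePQ.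
rewrite [LHS]mulrDr; congr (_ * expco _ _ + _ * expco _ _); apply/rowP => q; rewrite !mxE;
  by move: (y1 0 q) (y2 0 q) (y3 0 q) (y4 0 q) => *; ring.
Qed.

Lemma quadratic_coef2 (m : int) :
  eP m * ((M - m)%:~R * (eQ (m - M) + eQ (N + M - m))) =
  - ((kap 0 1 + 1)%:~R *
     (expco ((- M) *: (y2 - y3) + (- (m *: (y1 - y2 + y3)) - (M + N - m) *: y4))
        (kap + delta_mx 0 1) +
      expco ((- M) *: (y2 - y4) + (- (m *: (y1 - y2 + y4)) - (M + N - m) *: y3))
        (kap + delta_mx 0 1))).
Proof.
rewrite [in RHS]mulrDr !quadratic_term2 // opprD !opprK [LHS]mulrCA [eP m * _]mulrDr !ePQ.
rewrite [LHS]mulrDr; congr (_ * expco _ _ + _ * expco _ _); apply/rowP => q; rewrite !mxE;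
  by move: (y1 0 q) (y2 0 q) (y3 0 q) (y4 0 q) => *; ring.
Qed.

Lemma central_coef (B : nat) : (absz M <= B)%N ->
  \sum_(m <- irange B) eP m *
    ((M - m)%:~R * (eQ (m - M) + eQ (N + M - m)) * (m *+ ((0 < m) && (M + N == 0)))%:~R +
     m%:~R * (eQ (- m) + eQ (N + m)) * ((N + m) *+ ((0 < N + m) && (M + N == 0)))%:~R) =
  (kap 0 0 + 1)%:~R *
    ((if M + N == 0 then smul4 (expco ((- M) *: (y1 - y3))) (csub (- y1 + y2 + y3 - y4))
        (kap + delta_mx 0 0) else 0) +
     (if M + N == 0 then smul4 (expco ((- M) *: (y1 - y4))) (csub (- y1 + y2 + y4 - y3))
        (kap + delta_mx 0 0) else 0)) +
  (kap 0 1 + 1)%:~R *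
    ((if M + N == 0 then smul4 (expco ((- M) *: (y2 - y3))) (csub (y1 - y2 + y3 - y4))
        (kap + delta_mx 0 1) else 0) +
     (if M + N == 0 then smul4 (expco ((- M) *: (y2 - y4))) (csub (y1 - y2 + y4 - y3))
        (kap + delta_mx 0 1) else 0)).
Proof.
move=> hM; have [MN|_] := eqVneq (M + N) 0; last first.
  rewrite !addr0 !mulr0 addr0 big1 // => m _.
  by rewrite !andbF !mulr0n !mulr0 addr0 mulr0.
have NE : N = - M by lia.
have regroup (a b x y z w : CC) : a * (x + y) + b * (z + w) = (a * x + b * w) + (a * y + b * z).
  by ring.
have h1 := central_term kap y10 y11 y20 y21 y30 y31 y40 y41 hM.
have h2 := central_term kap y10 y11 y20 y21 y40 y41 y30 y31 hM.
rewrite [RHS]regroup; apply: esym; apply: (etrans (congr2 +%R h1 h2)); apply: esym.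
rewrite -big_split; apply: eq_bigr => m _ /=; rewrite -[RHS]mulrDr step_diff_strict !andbT.
have e1 : eP m * eQ (- m) = expco (- (m *: y1) - (M - m) *: y2 + (m *: y3 + (M - m) *: y4)) kap.
  rewrite ePQ NE; congr expco; apply/rowP => q; rewrite !mxE.
  by move: (y1 0 q) (y2 0 q) (y3 0 q) (y4 0 q) => *; ring.
have e2 : eP m * eQ (N + m) = expco (- (m *: y1) - (M - m) *: y2 + (m *: y4 + (M - m) *: y3)) kap.
  rewrite ePQ NE; congr expco; apply/rowP => q; rewrite !mxE.
  by move: (y1 0 q) (y2 0 q) (y3 0 q) (y4 0 q) => *; ring.
(* Since [N = - M], both brackets on the left equal [eQ (- m) + eQ (N + m)], which factors out. *)
rewrite -e1 -e2; have -> : m - M = N + m by rewrite NE; lia.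
have -> : N + M - m = - m by rewrite NE; lia.
move: ((m *+ (0 < m)%R)%:~R : CC) (((N + m) *+ (0 < N + m)%R)%:~R : CC) => p1 p2.
by ring.
Qed.

End Coefficients.

Theorem theorem3p1 (v : S) (k : E) :
  opbr (Lbar (yv 1) (yv 2) X1) (Lbar (yv 3) (yv 4) X2) v k =
  opadd
    (opscale (- 2^-1)
       (dop (Yv 1)
          (opadd (scmul (Delta (yv 1) (yv 3)) (Lbar (- yv 1 + yv 2 + yv 3) (yv 4) X2))
                 (scmul (Delta (yv 1) (yv 4)) (Lbar (- yv 1 + yv 2 + yv 4) (yv 3) X2)))))
    (opscale (- 2^-1)
       (dop (Yv 2)
          (opadd (scmul (Delta (yv 2) (yv 3)) (Lbar (yv 1 - yv 2 + yv 3) (yv 4) X2))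
                 (scmul (Delta (yv 2) (yv 4)) (Lbar (yv 1 - yv 2 + yv 4) (yv 3) X2)))))
    v k.
Proof.
pose M := - k 0 X1; pose N := - k 0 X2; pose kap := ypart k.
have y10 : yv 1 0 0 = 1 by rewrite yvE.
have y11 : yv 1 0 1 = 0 by rewrite yvE.
have y20 : yv 2 0 0 = 0 by rewrite yvE.
have y21 : yv 2 0 1 = 1 by rewrite yvE.
have y30 : yv 3 0 0 = 0 by rewrite yvE.
have y31 : yv 3 0 1 = 0 by rewrite yvE.
have y40 : yv 4 0 0 = 0 by rewrite yvE.
have y41 : yv 4 0 1 = 0 by rewrite yvE.
pose eP := NOco (yv 1) (yv 2) M (ypart12 kap); pose eQ := NOco (yv 3) (yv 4) N (ypart34 kap).
have ePQ m r : eP m * eQ r =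
    expco (- (m *: yv 1) - (M - m) *: yv 2 + (- (r *: yv 3) - (N - r) *: yv 4)) kap.
  have coord0 (p s : int) a b q : a 0 q = 0 -> b 0 q = 0 -> (- (p *: a) - s *: b) 0 q = 0.
    by move=> aq bq; rewrite !mxE aq bq !mulr0 subr0.
  by apply: expco_split => q q2; apply: coord0; rewrite yvE //; case: q q2 => -[|[|q]].
have k1E : k 0 (Yv 1) = kap 0 0 := YvE k 0.
have k2E : k 0 (Yv 2) = kap 0 1 := YvE k 1.
have [B1 hB1] := modesum_bracket_normal nopE nopC nop_eventually0 nop_bracket eP eQ M N v.
have [B2 hB2] := modesumE nop_eventually0 (M + N) v.
have [B3 hB3] := modesum_reflect nop_eventually0 (M + N) M v.
pose B := (B1 + B2 + B3 + absz M)%N.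
have [le1 [le2 [le3 leM]]] : (B1 <= B /\ B2 <= B /\ B3 <= B /\ absz M <= B)%N by rewrite /B; lia.
have neq0 l l' : l 0 0 != 0 -> l' 0 0 = 0 -> (l - l') 0 0 != 0.
  by move=> l0 l'0; rewrite mxE [X in _ + X]mxE l'0 subr0.
have n13 : (- yv 1 + yv 2 + yv 3 - yv 4) 0 0 != 0.
  by apply: neq0 y40; rewrite mxE y30 mxE y20 mxE y10.
have n14 : (- yv 1 + yv 2 + yv 4 - yv 3) 0 0 != 0.
  by apply: neq0 y30; rewrite mxE y40 mxE y20 mxE y10.
have n23 : (yv 1 - yv 2 + yv 3 - yv 4) 0 0 != 0.
  by apply: neq0 y40; rewrite mxE y30 mxE y10 mxE y20.
have n24 : (yv 1 - yv 2 + yv 4 - yv 3) 0 0 != 0.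
  by apply: neq0 y30; rewrite mxE y40 mxE y10 mxE y20.
have half (x y : S) (c : CC) : x = y -> 2^-1 *: (x - c *: v) = 2^-1 *: (y - c *: v) by move->.
(* The [y1] terms are written in reflected modes and the [y2] terms in direct ones, the two families
   that the bracket produces. *)
have T13 := etrans (scmul_shift 0 (yv 1) (yv 3) v k n13) (half _ _ _ (hB3 _ B le3)).
have T14 := etrans (scmul_shift 0 (yv 1) (yv 4) v k n14) (half _ _ _ (hB3 _ B le3)).
have T23 := etrans (scmul_shift 1 (yv 2) (yv 3) v k n23) (half _ _ _ (hB2 _ B le2)).
have T24 := etrans (scmul_shift 1 (yv 2) (yv 4) v k n24) (half _ _ _ (hB2 _ B le2)).
apply: (etrans (opbrE v k)); apply: esym.
apply: (etrans (congr2 (fun x y : S => - 2^-1 *: ((k 0 (Yv 1) + 1)%:~R *: x) +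
                                  - 2^-1 *: ((k 0 (Yv 2) + 1)%:~R *: y))
         (congr2 +%R T13 T14) (congr2 +%R T23 T24))).
apply: (etrans (quarter_combine _ _ _ _ _ _ _ _ _ _ _ _ _ _)).
apply: congr1; apply: esym; apply: (etrans (hB1 B le1)).
rewrite k1E k2E -/kap -/M -/N.
apply: sum_ext => [m|m|].
- exact: (quadratic_coef2 y11 y21 y31 y41 ePQ m).
- exact: (quadratic_coef1 y10 y20 y30 y40 ePQ m).
- exact: (central_coef y10 y11 y20 y21 y30 y31 y40 y41 ePQ leM).
Qed.
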